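(* Let $A=\bigoplus_{d\ge0}A_d$ be a Koszul algebra over a field $\Bbbk$, and let $B=\underline{\mathrm{end}}\,A$ be its associated bialgebra. For $\ell\ge0$ let $\chi_{A_\ell}\in B$ be the character of the left $B$-comodule $A_\ell$, and for $m\ge 0$ let $\chi_{A^{!\,*}_m}\in B$ be the character of the left $B$-comodule $A^{!\,*}_m$ (the linear dual of the degree-$m$ component of the quadratic dual $A^!$). Then in the power series ring $B[[t]]$ $$\left(\sum_{\ell\ge0}\chi_{A_\ell}\,t^\ell\right)\cdot\left(\sum_{m\ge0}(-1)^m\chi_{A^{!\,*}_m}\,t^m\right)=1 .$$
   Context: All tensor products are over the field $\Bbbk$; $\mathsf T(V)$ denotes the tensor algebra of $V$; $t$ is a central variable. Quadratic algebra: $A=\mathsf T(V)/(R(A))$ with $V$ a finite-dimensional $\Bbbk$-vector space and $R(A)\subseteq V^{\otimes2}$ a subspace; it is graded with $A_0=\Bbbk$, $A_1=V$. Fix a basis $\tilde x_1,\dots,\tilde x_n$ of $V$ with images $x_i$ in $A$, and let $\tilde x^1,\dots,\tilde x^n$ be the dual basis of $V^*$. Quadratic dual: $A^!=\mathsf T(V^* )/(R(A)^\perp)$, where $R(A)^\perp\subseteq (V^{\otimes 2})^*=V^{*\otimes2}$ is the space of linear forms vanishing on $R(A)$. Bialgebra $\underline{\mathrm{end}}\,A$: $\underline{\mathrm{end}}\,A=\mathsf T(V^*\otimes V)/\bigl(S_{23}(R(A)^\perp\otimes R(A))\bigr)$, where $S_{23}:V^{*\otimes2}\otimes V^{\otimes2}\to(V^*\otimes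 V)^{\otimes2}$ switches the second and third tensor factors. It is generated by the images $z_i^j$ of $\tilde x^j\otimes\tilde x_i$ and is a bialgebra with $\Delta(z_i^j)=\sum_\ell z_i^\ell\otimes z_\ell^j$, $\epsilon(z_i^j)=\delta_{i,j}$. Comodule structures: write $B=\underline{\mathrm{end}}\,A$. $A$ is a left $B$-comodule algebra via the algebra map $\delta_A:A\to B\otimes A$, $\delta_A(x_i)=\sum_j z_i^j\otimes x_j$, which restricts to a coaction on each $A_\ell$. The tensor algebra $\mathsf T(V)$ is a left $B$-comodule via the algebra map $\delta':\mathsf T(V)\to B\otimes\mathsf T(V)$, $\delta'(\tilde x_i)=\sum_j z_i^j\otimes\tilde x_j$. The space $A^{!\,*}_m$ is identified with the subspace $\bigcap_{i=0}^{m-2}V^{\otimes i}\otimes R(A)\otimes V^{\otimes (m-2-i)}$ of $V^{\otimes m}$ (all of $V^{\otimes m}$ if $m\le1$), and is a left $B$-comodule by restriction of $\delta'$. Koszul algebra: for $\ell>0$ the Koszul complex $\mathsf K^{\ell,\bullet}(A)$ is $$0\to A^{!\,*}_\ell\to A^{!\,*}_{\ell-1}\otimes A_1\to\dots\to A^{!\,*}_1\otimes A_{\ell-1}\to A_\ell\to0,$$ with differential $A^{!\,*}_{m+1}\otimes A_{k-1}\to A^{!\,*}_m\otimes A_k$ induced by the inclusion $A^{!\,*}_{m+1}\otimes V^{\otimes (k-1)}\hookrightarrow A^{!\,*}_m\otimes V^{\otimes k}$ of subspaces of $V^{\otimes(m+k)}$. A quadratic algebra $A$ is Koszul if $\mathsf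 K^{\ell,\bullet}(A)$ is exact for all $\ell>0$. Character: for a finite-dimensional left $B$-comodule $W$ with basis $\{v_i\}$ and coaction $\delta_W(v_j)=\sum_i b_{i,j}\otimes v_i$, the character is $\chi_W=\sum_i b_{i,i}\in B$ (independent of the basis). *)

(* Defs.v *)
From HB Require Import structures.
From mathcomp Require Import all_boot all_order all_algebra finmap.
From mathcomp Require Import generic_quotient ring_quotient.
From mathcomp Require Import boolp classical_sets.
From mathcomp.multinomials Require Import monalg.

Set Implicit Arguments.
Unset Strict Implicit.
Unset Printing Implicit Defensive.

Import GRing.Theory.
Local Open Scope ring_scope.
Local Open Scope quotient_scope.
Local Open Scope classical_set_scope.

Section Span.
Variables (k : fieldType) (V : lmodType k).

Inductive lspan (P : set V) : V -> Prop :=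
| lspan0 : lspan P 0
| lspanD (a : k) (x y : V) : P x -> lspan P y -> lspan P (a *: x + y).

Lemma lspan_add (P : set V) x y : lspan P x -> lspan P y -> lspan P (x + y).
Proof.
move=> Px Py; elim: Px => [|a u v Pu _ IH]; first by rewrite add0r.
by rewrite -addrA; apply: lspanD.
Qed.

Lemma lspan_scale (P : set V) c x : lspan P x -> lspan P (c *: x).
Proof.
elim=> [|a u v Pu _ IH]; first by rewrite scaler0; apply: lspan0.
by rewrite scalerDr scalerA; apply: lspanD.
Qed.

Lemma lspan_mem (P : set V) x : P x -> lspan P x.
Proof. by move=> Px; rewrite -[x]addr0 -[x]scale1r; apply: lspanD => //; apply: lspan0. Qed.

Definition lspanp (P : set V) : {pred V} := fun x => `[<lspan P x>].

Lemma lspanp_closed (P : set V) : GRing.zmod_closed (lspanp P).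
Proof.
split=> [|x y /asboolP Px /asboolP Py]; apply/asboolP; first exact: lspan0.
by apply: lspan_add => //; rewrite -scaleN1r; apply: lspan_scale.
Qed.

HB.instance Definition _ P := GRing.isZmodClosed.Build V (lspanp P) (lspanp_closed P).

Definition lquot (P : set V) := Quotient.quot (lspanp P).

End Span.

Section LQuot.
Variables (k : fieldType) (V : lmodType k) (P : set V).
Local Notation Q := (lquot P).

HB.instance Definition _ := Choice.on Q.
HB.instance Definition _ := GRing.Zmodule.on Q.

Definition qpi (x : V) : Q := \pi_(Q) x.
Definition qrepr (q : Q) : V := repr q.

Lemma qreprK q : qpi (qrepr q) = q.
Proof. exact: reprK. Qed.

Lemma qpi_eq x y : qpi x = qpi y <-> lspan P (x - y).
Proof.
split=> [/eqP|] h; last apply/eqP; move: h; rewrite /qpi -Quotient.idealrBE.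
  by move/asboolP.
by move=> h; apply/asboolP.
Qed.

Lemma qpiD x y : qpi (x + y) = qpi x + qpi y.
Proof. by rewrite /qpi piE. Qed.

End LQuot.

HB.lock Definition qscale (k : fieldType) (V : lmodType k) (P : set V) (a : k)
  (q : lquot P) : lquot P := qpi P (a *: qrepr q).

Section LQuotModule.
Variables (k : fieldType) (V : lmodType k) (P : set V).
Local Notation Q := (lquot P).
Local Notation qpi := (qpi P).
Local Notation qscale := (@qscale k V P).

Lemma qpi_scale a x : qpi (a *: x) = qscale a (qpi x).
Proof.
rewrite qscale.unlock; apply/qpi_eq; rewrite -scalerBr; apply: lspan_scale.
by apply/qpi_eq; rewrite qreprK.
Qed.

Lemma qscaleA a b q : qscale a (qscale b q) = qscale (a * b) q.
Proof. by rewrite -(qreprK q) -!qpi_scale scalerA. Qed.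
Lemma qscale1 : left_id 1 qscale.
Proof. by move=> q; rewrite -(qreprK q) -qpi_scale scale1r. Qed.
Lemma qscaleDr : right_distributive qscale +%R.
Proof.
by move=> a p q; rewrite -(qreprK p) -(qreprK q) -!(qpiD, qpi_scale) scalerDr.
Qed.
Lemma qscaleDl q : {morph qscale^~ q : a b / a + b}.
Proof. by move=> a b; rewrite -(qreprK q) -!(qpiD, qpi_scale) scalerDl. Qed.

HB.instance Definition _ := GRing.Zmodule_isLmodule.Build k Q
  qscaleA qscale1 qscaleDr qscaleDl.

Lemma qpiZ a x : qpi (a *: x) = a *: qpi x. Proof. exact: qpi_scale. Qed.
Lemma qpi0 : qpi 0 = 0.
Proof. by rewrite -[in LHS](scale0r 0) qpiZ scale0r. Qed.

Lemma qpi_linear : linear qpi.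
Proof. by move=> a x y; rewrite qpiD qpiZ. Qed.

Definition qlift (W : lmodType k) (f : V -> W) (q : Q) : W := f (qrepr q).

Lemma qliftE (W : lmodType k) (f : V -> W) : linear f ->
  (forall x, P x -> f x = 0) -> forall x, qlift f (qpi x) = f x.
Proof.
move=> flin fP x; rewrite /qlift.
have f0 : f 0 = 0 by have := flin (-1) 0 0; rewrite scaleN1r addNr scaleN1r addNr.
have fs y : lspan P y -> f y = 0.
  by elim=> [//|a u v Pu _ IH]; rewrite flin IH fP // scaler0 addr0.
have /qpi_eq/fs : qpi (qrepr (qpi x)) = qpi x by rewrite qreprK.
rewrite addrC -scaleN1r flin scaleN1r addrC => /eqP.
by rewrite subr_eq0 => /eqP.
Qed.

End LQuotModule.

Section FreeAlg.
Variables (k : fieldType) (X : choiceType).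

(* The free algebra k<X>: linear combinations of words over X.  It is the
   tensor algebra T(V) of the space V with basis X. *)
Definition freealg := {malg k[{fmonom X}]}.
HB.instance Definition _ := GRing.Lmodule.on freealg.

End FreeAlg.

HB.lock Definition freealg_mul (k : fieldType) (X : choiceType)
  (x y : freealg k X) : freealg k X := (x : {malg k[{fmonom X}]}) * y.

Section FreeAlgRing.
Variables (k : fieldType) (X : choiceType).
Local Notation F := (freealg k X).
Local Notation mul := (@freealg_mul k X).

Lemma freealg_mulA : associative mul.
Proof. by rewrite freealg_mul.unlock; exact: mulrA. Qed.
Lemma freealg_mul1r : left_id (1 : {malg k[{fmonom X}]}) mul.
Proof. by rewrite freealg_mul.unlock; exact: mul1r. Qed.
Lemma freealg_mulr1 : right_id (1 : {malg k[{fmonom X}]}) mul.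
Proof. by rewrite freealg_mul.unlock; exact: mulr1. Qed.
Lemma freealg_mulDl : left_distributive mul +%R.
Proof. by rewrite freealg_mul.unlock; exact: mulrDl. Qed.
Lemma freealg_mulDr : right_distributive mul +%R.
Proof. by rewrite freealg_mul.unlock; exact: mulrDr. Qed.
Lemma freealg_one_neq0 : (1 : {malg k[{fmonom X}]}) != 0 :> F.
Proof. exact: oner_neq0. Qed.

HB.instance Definition _ := GRing.Zmodule_isNzRing.Build F freealg_mulA
  freealg_mul1r freealg_mulr1 freealg_mulDl freealg_mulDr freealg_one_neq0.

Lemma freealg_scalerAl (a : k) (x y : F) : a *: mul x y = mul (a *: x) y.
Proof. rewrite freealg_mul.unlock; exact: (@scalerAl k {malg k[{fmonom X}]}). Qed.

Lemma freealg_scalerAr (a : k) (x y : F) : a *: mul x y = mul x (a *: y).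
Proof.
suff H (u v : {malg k[{fmonom X}]}) : a *: (u * v) = u * (a *: v).
  by rewrite freealg_mul.unlock; exact: H.
apply/malgP => w; apply: etrans (mcoeffZ a (u * v) w) _.
apply: etrans (esym (mcoeffMlw w (fsubset_refl (msupp u)) (msuppZ_le a v))).
rewrite mcoeffMl mulr_sumr.
apply: eq_bigr => s _; rewrite mulr_sumr; apply: eq_bigr => t _.
by rewrite mcoeffZ mulrnAr mulrCA.
Qed.

HB.instance Definition _ := GRing.Lmodule_isLalgebra.Build k F freealg_scalerAl.
HB.instance Definition _ := GRing.Lalgebra_isAlgebra.Build k F freealg_scalerAr.

Lemma freealg_mulE (x y : F) : x * y = (x : {malg k[{fmonom X}]}) * y.
Proof. by rewrite -[LHS]/(mul x y) freealg_mul.unlock. Qed.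

End FreeAlgRing.

HB.lock Definition word (k : fieldType) (X : choiceType) (s : seq X) :
  freealg k X := << FMonom s >>.
Arguments word k {X} s.

Section FreeAlgTheory.
Variables (k : fieldType) (X : choiceType).
Local Notation freealg := (freealg k X).
Local Notation word := (@word k X).

Lemma wordE s : word s = << FMonom s >>. Proof. by rewrite word.unlock. Qed.

Definition gen (x : X) : freealg := word [:: x].

Lemma freealg_ind (Q : freealg -> Prop) :
  Q 0 -> (forall c s p, Q p -> Q (c *: word s + p)) -> forall p, Q p.
Proof.
move=> Q0 QD p; rewrite -[p]/(p : {malg k[{fmonom X}]}) (monalgE p).
elim/big_rec: _ => [//|w y _]; set c := _@_w.
suff -> : << c *g w >> = c *: word w :> freealg by exact: QD.
rewrite wordE fmK; apply/malgP => v; apply: esym; apply: etrans (mcoeffZ _ _ _) _.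
by rewrite [X in _ * X]mcoeffU mcoeffU mulrnAr mulr1.
Qed.

Lemma wordM s t : word s * word t = word (s ++ t).
Proof.
rewrite freealg_mulE !wordE; apply: etrans (fgmulUU _ _ _ _) _; rewrite mulr1.
congr << _ >>.
by apply/eqP; rewrite fmP fmM.
Qed.

Definition constcoef (p : freealg) : k :=
  (p : {malg k[{fmonom X}]})@_(mone : {fmonom X}).

Lemma constcoef_lin a p q :
  constcoef (a *: p + q) = a * constcoef p + constcoef q.
Proof. by rewrite -mcoeffZ -mcoeffD. Qed.
Lemma constcoefM p q : constcoef (p * q) = constcoef p * constcoef q.
Proof. by rewrite freealg_mulE; exact: (rmorphM (mcoeff (mone : {fmonom X}))). Qed.
Lemma constcoef0 : constcoef 0 = 0. Proof. exact: mcoeff0. Qed.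
Lemma constcoef1 : constcoef 1 = 1.
Proof. exact: (rmorph1 (mcoeff (mone : {fmonom X}))). Qed.
Lemma constcoef_gen x : constcoef (gen x) = 0.
Proof.
rewrite /constcoef /gen wordE mcoeffU1; suff /negbTE-> : FMonom [:: x] != mone by [].
by rewrite fmP fm1.
Qed.

(* The component of degree m, i.e. the m-th tensor power of V. *)
Definition freealg_deg (m : nat) : set freealg :=
  [set p | forall w : {fmonom X}, w \in msupp p -> size w = m].

End FreeAlgTheory.

Section IdealQuot.
Variables (k : fieldType) (T : algType k) (S : set T).

Definition ideal_gens : set T := [set u | exists a s b, S s /\ u = a * s * b].

(* The quotient of T by the two-sided ideal generated by S, with its
   multiplication and unit; they make it a ring, possibly a trivial one. *)
Definition idquot := lquot ideal_gens.
HB.instance Definition _ := GRing.Lmodule.on idquot.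

Definition iq_pi : T -> idquot := @qpi k T ideal_gens.
Definition iq_one : idquot := iq_pi 1.

End IdealQuot.

HB.lock Definition iq_mul (k : fieldType) (T : algType k) (S : set T)
  (p q : idquot S) : idquot S := iq_pi S (qrepr p * qrepr q).

Section IdealQuotRing.
Variables (k : fieldType) (T : algType k) (S : set T).
Local Notation idquot := (idquot S).
Local Notation ideal_gens := (ideal_gens S).
Local Notation iq_pi := (iq_pi S).
Local Notation iq_one := (iq_one S).
Local Notation iq_mul := (@iq_mul k T S).

Lemma iq_reprK (p : idquot) : iq_pi (qrepr p) = p. Proof. exact: qreprK. Qed.
Lemma iq_piD x y : iq_pi (x + y) = iq_pi x + iq_pi y.
Proof. exact: qpiD. Qed.
Lemma iq_piZ a x : iq_pi (a *: x) = a *: iq_pi x.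
Proof. exact: qpiZ. Qed.

Lemma ideal_mull c x : lspan ideal_gens x -> lspan ideal_gens (c * x).
Proof.
elim=> [|a u v [p [s [q [Ss ->]]]] _ IH]; first by rewrite mulr0; apply: lspan0.
rewrite mulrDr -scalerAr; apply: lspanD => //.
by exists (c * p), s, q; rewrite !mulrA.
Qed.

Lemma ideal_mulr c x : lspan ideal_gens x -> lspan ideal_gens (x * c).
Proof.
elim=> [|a u v [p [s [q [Ss ->]]]] _ IH]; first by rewrite mul0r; apply: lspan0.
rewrite mulrDl -scalerAl; apply: lspanD => //.
by exists p, s, (q * c); rewrite !mulrA.
Qed.

Lemma iq_piM x y : iq_pi (x * y) = iq_mul (iq_pi x) (iq_pi y).
Proof.
rewrite iq_mul.unlock; apply/qpi_eq; set x' := qrepr _; set y' := qrepr _.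
have -> : x * y - x' * y' = (x - x') * y + x' * (y - y').
  by rewrite mulrBl mulrBr addrA addrNK.
by apply: lspan_add; [apply: ideal_mulr | apply: ideal_mull];
  apply/qpi_eq; rewrite qreprK.
Qed.

Lemma iq_mulA : associative iq_mul.
Proof.
move=> x y z; rewrite -(iq_reprK x) -(iq_reprK y) -(iq_reprK z).
by rewrite -!iq_piM mulrA.
Qed.
Lemma iq_mul1r : left_id iq_one iq_mul.
Proof. by move=> x; rewrite -(iq_reprK x) -iq_piM mul1r. Qed.
Lemma iq_mulr1 : right_id iq_one iq_mul.
Proof. by move=> x; rewrite -(iq_reprK x) -iq_piM mulr1. Qed.
Lemma iq_mulDl : left_distributive iq_mul +%R.
Proof.
move=> x y z; rewrite -(iq_reprK x) -(iq_reprK y) -(iq_reprK z).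
by rewrite -iq_piD -!iq_piM mulrDl iq_piD.
Qed.
Lemma iq_mulDr : right_distributive iq_mul +%R.
Proof.
move=> x y z; rewrite -(iq_reprK x) -(iq_reprK y) -(iq_reprK z).
by rewrite -iq_piD -!iq_piM mulrDr iq_piD.
Qed.
Lemma iq_scalerAl (a : k) (x y : idquot) : a *: iq_mul x y = iq_mul (a *: x) y.
Proof.
rewrite -(iq_reprK x) -(iq_reprK y) -iq_piM -!iq_piZ -iq_piM.
by rewrite scalerAl.
Qed.
Lemma iq_scalerAr (a : k) (x y : idquot) : a *: iq_mul x y = iq_mul x (a *: y).
Proof.
rewrite -(iq_reprK x) -(iq_reprK y) -iq_piM -!iq_piZ -iq_piM.
by rewrite scalerAr.
Qed.

End IdealQuotRing.

Section QuadAlg.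
Variables (k : fieldType) (X : finType) (S : set (X -> X -> k)).

(* The element of the tensor square of V with coordinates r. *)
Definition quadelt (r : X -> X -> k) : freealg k X :=
  \sum_(p : X * X) r p.1 p.2 *: (gen k p.1 * gen k p.2).

Definition quadalg := idquot (quadelt @` S).
HB.instance Definition _ := GRing.Lmodule.on quadalg.

Definition qa_pi : freealg k X -> quadalg := @iq_pi k _ (quadelt @` S).

Lemma quadelt_const r : constcoef (quadelt r) = 0.
Proof.
rewrite /quadelt; elim/big_rec: _ => [|p x _ IH]; first exact: constcoef0.
by rewrite constcoef_lin IH constcoefM constcoef_gen mul0r mulr0 addr0.
Qed.

Lemma qa_one_neq0 : iq_one (quadelt @` S) != 0 :> quadalg.
Proof.
apply/eqP; have <- : qa_pi 0 = 0 by exact: qpi0.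
move/qpi_eq; rewrite subr0.
suff H x : lspan (ideal_gens (quadelt @` S)) x -> constcoef x = 0.
  by move/H/eqP; rewrite constcoef1 oner_eq0.
elim=> [|a u v [p [s [q [[r _ <-] ->]]]] _ IH]; first exact: constcoef0.
by rewrite constcoef_lin IH !constcoefM quadelt_const mulr0 mul0r mulr0 addr0.
Qed.

HB.instance Definition _ := GRing.Zmodule_isNzRing.Build quadalg
  (@iq_mulA _ _ _) (@iq_mul1r _ _ _) (@iq_mulr1 _ _ _)
  (@iq_mulDl _ _ _) (@iq_mulDr _ _ _) qa_one_neq0.
HB.instance Definition _ := GRing.Lmodule_isLalgebra.Build k quadalg
  (@iq_scalerAl _ _ (quadelt @` S)).
HB.instance Definition _ := GRing.Lalgebra_isAlgebra.Build k quadalg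
  (@iq_scalerAr _ _ (quadelt @` S)).

Lemma qa_pi_linear : linear qa_pi.
Proof. by move=> a x y; rewrite /qa_pi iq_piD iq_piZ. Qed.
Lemma qa_piM x y : qa_pi (x * y) = qa_pi x * qa_pi y.
Proof. exact: iq_piM. Qed.
Lemma qa_pi1 : qa_pi 1 = 1. Proof. by []. Qed.

Definition quadalg_deg (m : nat) : set quadalg := qa_pi @` freealg_deg m.

End QuadAlg.

Section Tensor.
Variables (k : fieldType) (M N : lmodType k).
Local Notation F := {malg k[(M * N)%type]}.
Local Notation "<| m , n |>" := (<< (m, n) >> : F).

Inductive tensor_rel : set F :=
| tensor_relDl m m' n : tensor_rel (<| m + m', n |> - <| m, n |> - <| m', n |>)
| tensor_relDr m n n' : tensor_rel (<| m, n + n' |> - <| m, n |> - <| m, n' |>)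
| tensor_relZl a m n : tensor_rel (<| a *: m, n |> - a *: <| m, n |>)
| tensor_relZr a m n : tensor_rel (<| m, a *: n |> - a *: <| m, n |>).

(* The tensor product of M and N over k. *)
Definition tensor := lquot tensor_rel.
HB.instance Definition _ := GRing.Lmodule.on tensor.

End Tensor.

HB.lock Definition tens (k : fieldType) (M N : lmodType k) (m : M) (n : N) :
  tensor M N := qpi _ (<< (m, n) >> : {malg k[(M * N)%type]}).
Arguments tens {k M N} m n.

Section TensorTheory.
Variables (k : fieldType) (M N : lmodType k).
Local Notation F := {malg k[(M * N)%type]}.
Local Notation "<| m , n |>" := (<< (m, n) >> : F).
Local Notation tensor := (tensor M N).
Local Notation tensor_rel := (@tensor_rel k M N).
Local Notation tens := (@tens k M N).

Lemma tensDl m m' n : tens (m + m') n = tens m n + tens m' n.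
Proof.
rewrite tens.unlock -[RHS]qpiD; apply/qpi_eq/lspan_mem.
by rewrite opprD addrA; apply: tensor_relDl.
Qed.
Lemma tensDr m n n' : tens m (n + n') = tens m n + tens m n'.
Proof.
rewrite tens.unlock -[RHS]qpiD; apply/qpi_eq/lspan_mem.
by rewrite opprD addrA; apply: tensor_relDr.
Qed.
Lemma tensZl a m n : tens (a *: m) n = a *: tens m n.
Proof. by rewrite tens.unlock -[RHS]qpiZ; apply/qpi_eq/lspan_mem/tensor_relZl. Qed.
Lemma tensZr a m n : tens m (a *: n) = a *: tens m n.
Proof. by rewrite tens.unlock -[RHS]qpiZ; apply/qpi_eq/lspan_mem/tensor_relZr. Qed.

Lemma tensor_ind (Q : tensor -> Prop) :
  Q 0 -> (forall m n x, Q x -> Q (tens m n + x)) -> forall x, Q x.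
Proof.
move=> Q0 QD x; rewrite -(qreprK x) (monalgE (qrepr x)).
elim/big_rec: _ => [|p y _ IH].
  by rewrite qpi0.
rewrite qpiD; set c := (_)@_p.
suff -> : qpi tensor_rel << c *g p >> = tens (c *: p.1) p.2 by apply: QD.
rewrite tensZl tens.unlock -[RHS]qpiZ; congr (qpi _ _); apply/malgP => w.
by rewrite mcoeffZ !mcoeffU -surjective_pairing mulrnAr mulr1.
Qed.

Section Lift.
Variables (W : lmodType k) (f : M -> N -> W).

Definition bilin_ext (u : F) : W := \sum_(p <- msupp u) u@_p *: f p.1 p.2.

(* The linear map on the tensor product induced by a bilinear map f. *)
Definition tlift : tensor -> W := qlift bilin_ext.

Lemma bilin_extEw (d : {fset M * N}) (u : F) : (msupp u `<=` d)%fset ->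
  bilin_ext u = \sum_(p <- d) u@_p *: f p.1 p.2.
Proof.
move=> le_d; apply: big_fset_incl => // p _ /mcoeff_outdom ->.
by rewrite scale0r.
Qed.

Lemma bilin_ext_linear : linear bilin_ext.
Proof.
move=> a u v; pose d := (msupp u `|` msupp v `|` msupp (a *: u + v))%fset.
have hw : (msupp (a *: u + v) `<=` d)%fset by exact: fsubsetUr.
have hu : (msupp u `<=` d)%fset by apply/fsubsetU; rewrite fsubsetUl.
have hv : (msupp v `<=` d)%fset by apply/fsubsetU; rewrite fsubsetUr.
rewrite (bilin_extEw hw) (bilin_extEw hu) (bilin_extEw hv).
rewrite scaler_sumr -big_split; apply: eq_bigr => p _ /=.
by rewrite mcoeffD mcoeffZ scalerDl scalerA.
Qed.

Lemma bilin_extU m n : bilin_ext <| m, n |> = f m n.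
Proof. by rewrite /bilin_ext msuppU oner_eq0 big_seq_fset1 mcoeffUU scale1r. Qed.

Hypothesis fl : forall n, linear (f^~ n).
Hypothesis fr : forall m, linear (f m).

Lemma tlift_key u : tensor_rel u -> bilin_ext u = 0.
Proof.
have b0 : bilin_ext 0 = 0 by rewrite /bilin_ext msupp0 big_seq_fset0.
have bZ a v : bilin_ext (a *: v) = a *: bilin_ext v.
  by have := bilin_ext_linear a v 0; rewrite b0 !addr0.
have bB v w : bilin_ext (v - w) = bilin_ext v - bilin_ext w.
  have := bilin_ext_linear (-1) w v; rewrite !scaleN1r [- bilin_ext w + _]addrC.
  by rewrite [- w + v]addrC.
case=> [m m' n|m n n'|a m n|a m n]; rewrite !(bB, bZ, bilin_extU).
- by have := fl n 1 m m'; rewrite !scale1r => ->; rewrite -[LHS]addrA -opprD subrr.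
- by have := fr m 1 n n'; rewrite !scale1r => ->; rewrite -[LHS]addrA -opprD subrr.
- have f0 : f 0 n = 0.
    by have := fl n (-1) 0 0; rewrite scaler0 addr0 scaleN1r addNr.
  by have := fl n a m 0; rewrite !addr0 f0 addr0 => ->; rewrite subrr.
- have f0 : f m 0 = 0.
    by have := fr m (-1) 0 0; rewrite scaler0 addr0 scaleN1r addNr.
  by have := fr m a n 0; rewrite !addr0 f0 addr0 => ->; rewrite subrr.
Qed.

Lemma tlift_linear : linear tlift.
Proof.
move=> a x y; rewrite -(qreprK x) -(qreprK y) -qpiZ -qpiD.
by rewrite /tlift !(qliftE bilin_ext_linear tlift_key) bilin_ext_linear.
Qed.

Lemma tliftE m n : tlift (tens m n) = f m n.
Proof. by rewrite tens.unlock /tlift (qliftE bilin_ext_linear tlift_key) bilin_extU. Qed.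

End Lift.

Lemma eq_tensor (W : lmodType k) (f g : tensor -> W) : linear f -> linear g ->
  (forall m n, f (tens m n) = g (tens m n)) -> f =1 g.
Proof.
move=> fL gL fg; elim/tensor_ind => [|m n x IH].
  by have := fL (-1) 0 0; have := gL (-1) 0 0;
    rewrite scaler0 addr0 !scaleN1r !addNr => -> ->.
by have := fL 1 (tens m n) x; have := gL 1 (tens m n) x;
  rewrite !scale1r IH fg => -> ->.
Qed.

End TensorTheory.

Section TensorAlg.
Variables (k : fieldType) (A B : algType k).
Local Notation AB := (tensor A B).

Lemma tens_linl n : linear (fun m => tens m n : AB).
Proof. by move=> a m m'; rewrite tensDl tensZl. Qed.
Lemma tens_linr m : linear (fun n => tens m n : AB).
Proof. by move=> a n n'; rewrite tensDr tensZr. Qed.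

(* (a (x) b) * (a' (x) b') = (a * a') (x) (b * b'), extended bilinearly. *)
Definition tens_mul1 (a : A) (b : B) : AB -> AB :=
  tlift (fun a' b' => tens (a * a') (b * b')).

Lemma tens_mul1_bil a b :
  (forall n, linear (fun m => tens (a * m) (b * n) : AB)) /\
  (forall m, linear (fun n => tens (a * m) (b * n) : AB)).
Proof.
split=> [n c x y|m c x y].
  by rewrite mulrDr -scalerAr tens_linl.
by rewrite mulrDr -scalerAr tens_linr.
Qed.

Lemma tens_mul1_linear a b : linear (tens_mul1 a b).
Proof. by have [h1 h2] := tens_mul1_bil a b; apply: tlift_linear. Qed.

Lemma tens_mul1E a b a' b' :
  tens_mul1 a b (tens a' b') = tens (a * a') (b * b').
Proof.
have [h1 h2] := tens_mul1_bil a b.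
exact: (tliftE (f := fun a' b' => tens (a * a') (b * b'))).
Qed.

Lemma tens_mul_bil (y : AB) :
  (forall b, linear (fun a => tens_mul1 a b y)) /\
  (forall a, linear (fun b => tens_mul1 a b y)).
Proof.
move: tens_mul1 tens_mul1_linear tens_mul1E => g gL gE.
have h0 a b : g a b 0 = 0.
  by have := gL a b (-1) 0 0; rewrite scaler0 addr0 scaleN1r addNr.
have hD a b p q : g a b (p + q) = g a b p + g a b q.
  by have := gL a b 1 p q; rewrite !scale1r.
split=> [b|a] c u v; elim/tensor_ind: y => [|m n y IH].
- by rewrite !h0 scaler0 addr0.
- rewrite !hD IH !gE mulrDl -scalerAl tens_linl scalerDr !addrA.
  by congr (_ + _); rewrite addrAC.
- by rewrite !h0 scaler0 addr0.
- rewrite !hD IH !gE mulrDl -scalerAl tens_linr scalerDr !addrA.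
  by congr (_ + _); rewrite addrAC.
Qed.

End TensorAlg.

HB.lock Definition tens_mul (k : fieldType) (A B : algType k)
  (x y : tensor A B) : tensor A B := tlift (fun a b => tens_mul1 a b y) x.

Section TensorAlgRing.
Variables (k : fieldType) (A B : algType k).
Local Notation AB := (tensor A B).
Local Notation tens_mul := (@tens_mul k A B).

Lemma tens_mul_linl y : linear (tens_mul^~ y).
Proof.
by rewrite tens_mul.unlock; have [h1 h2] := tens_mul_bil y; apply: tlift_linear.
Qed.

Lemma tens_mulUl a b y : tens_mul (tens a b) y = tens_mul1 a b y.
Proof.
have [h1 h2] := tens_mul_bil y; rewrite tens_mul.unlock.
exact: (tliftE (f := fun a b => tens_mul1 a b y)).
Qed.

Lemma tens_mulE a b a' b' :
  tens_mul (tens a b) (tens a' b') = tens (a * a') (b * b').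
Proof. by rewrite tens_mulUl tens_mul1E. Qed.

Lemma tens_mul0l y : tens_mul 0 y = 0.
Proof.
by have := tens_mul_linl y (-1) 0 0; rewrite scaler0 addr0 scaleN1r addNr.
Qed.

Lemma tens_mulDl : left_distributive tens_mul +%R.
Proof. by move=> x y z; have := tens_mul_linl z 1 x y; rewrite !scale1r. Qed.

Lemma tens_mul_linr x : linear (tens_mul x).
Proof.
move=> c u v; elim/tensor_ind: x => [|m n x IH].
  by rewrite !tens_mul0l scaler0 addr0.
rewrite !tens_mulDl IH !tens_mulUl tens_mul1_linear scalerDr !addrA.
by congr (_ + _); rewrite addrAC.
Qed.

Lemma tens_mulDr : right_distributive tens_mul +%R.
Proof. by move=> x y z; have := tens_mul_linr x 1 y z; rewrite !scale1r. Qed.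

Lemma tens_mul0r x : tens_mul x 0 = 0.
Proof.
by have := tens_mul_linr x (-1) 0 0; rewrite scaler0 addr0 scaleN1r addNr.
Qed.

Lemma tens_mulA : associative tens_mul.
Proof.
move: tens_mul tens_mulDl tens_mulDr tens_mul0l tens_mul0r tens_mulE.
move=> mu muDl muDr mu0l mu0r muE.
move=> x y z; elim/tensor_ind: x => [|a b x IH]; first by rewrite !mu0l.
rewrite !muDl IH; congr (_ + _).
elim/tensor_ind: y {IH} => [|a' b' y IHy]; first by rewrite mu0l mu0r mu0l.
rewrite muDl !muDr muDl IHy; congr (_ + _).
elim/tensor_ind: z {IHy} => [|a'' b'' z IHz]; first by rewrite !mu0r.
by rewrite !muDr IHz !muE !mulrA.
Qed.

Lemma tens_mul1r : left_id (tens 1 1) tens_mul.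
Proof.
elim/tensor_ind => [|a b x IH]; first by rewrite tens_mul0r.
by rewrite tens_mulDr IH tens_mulE !mul1r.
Qed.

Lemma tens_mulr1 : right_id (tens 1 1) tens_mul.
Proof.
elim/tensor_ind => [|a b x IH]; first by rewrite tens_mul0l.
by rewrite tens_mulDl IH tens_mulE !mulr1.
Qed.

HB.instance Definition _ := GRing.Zmodule_isPzRing.Build AB
  tens_mulA tens_mul1r tens_mulr1 tens_mulDl tens_mulDr.

Lemma tensM a b a' b' :
  tens a b * tens a' b' = tens (a * a') (b * b') :> AB.
Proof. exact: tens_mulE. Qed.

Lemma tens_scalerAl (c : k) (x y : AB) : c *: (x * y) = (c *: x) * y.
Proof.
have := tens_mul_linl y c x 0; rewrite !addr0 tens_mul0l addr0.
exact: esym.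
Qed.
Lemma tens_scalerAr (c : k) (x y : AB) : c *: (x * y) = x * (c *: y).
Proof.
have := tens_mul_linr x c y 0; rewrite !addr0 tens_mul0r addr0.
exact: esym.
Qed.

End TensorAlgRing.

Section FreeMap.
Variables (k : fieldType) (X : choiceType) (B C : algType k).
Variable f : X -> tensor B C.

(* The algebra map out of the free algebra determined by f on generators. *)
Definition free_map (p : freealg k X) : tensor B C :=
  \sum_(w <- msupp p) p@_w *: \prod_(x <- (w : {fmonom X})) f x.

Lemma free_mapEw (d : {fset {fmonom X}}) (p : freealg k X) :
  (msupp p `<=` d)%fset ->
  free_map p = \sum_(w <- d) p@_w *: \prod_(x <- (w : {fmonom X})) f x.
Proof.
move=> le_d; apply: big_fset_incl => // w _ /mcoeff_outdom ->.
by rewrite scale0r.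
Qed.

Lemma free_map_linear : linear free_map.
Proof.
move=> a u v; pose d := (msupp u `|` msupp v `|` msupp (a *: u + v))%fset.
have hw : (msupp (a *: u + v) `<=` d)%fset by exact: fsubsetUr.
have hu : (msupp u `<=` d)%fset by apply/fsubsetU; rewrite fsubsetUl.
have hv : (msupp v `<=` d)%fset by apply/fsubsetU; rewrite fsubsetUr.
rewrite (free_mapEw hw) (free_mapEw hu) (free_mapEw hv).
rewrite scaler_sumr -big_split; apply: eq_bigr => w _ /=.
suff -> : (a *: u + v)@_w = a * u@_w + v@_w by rewrite scalerDl scalerA.
by apply: etrans (mcoeffD _ _ _) _; congr (_ + _); exact: mcoeffZ.
Qed.

Lemma free_map_word s : free_map (word k s) = \prod_(x <- s) f x.
Proof.
by rewrite /free_map wordE msuppU1 big_seq_fset1 mcoeffUU scale1r.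
Qed.

Lemma free_map_gen x : free_map (gen k x) = f x.
Proof. by rewrite free_map_word big_seq1. Qed.

Lemma free_map1 : free_map 1 = 1.
Proof.
have -> : 1 = word k [::] :> freealg k X.
  by rewrite wordE; congr << _ >>; apply/eqP; rewrite fmP fm1.
by rewrite free_map_word big_nil.
Qed.

Lemma free_mapM p q : free_map (p * q) = free_map p * free_map q.
Proof.
have f0 : free_map 0 = 0 by rewrite /free_map msupp0 big_seq_fset0.
have fZ c u : free_map (c *: u) = c *: free_map u.
  by have := free_map_linear c u 0; rewrite f0 !addr0.
move: free_map free_map_linear free_map_word f0 fZ => g gL gw g0 gZ.
elim/freealg_ind: p => [|c s p IH]; first by rewrite mul0r g0 mul0r.
rewrite mulrDl -scalerAl !gL IH mulrDl -tens_scalerAl; congr (_ *: _ + _).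
elim/freealg_ind: q {IH} => [|d t q IH]; first by rewrite mulr0 g0 mulr0.
rewrite mulrDr -scalerAr !gL IH mulrDr -tens_scalerAr wordM !gw.
by rewrite big_cat.
Qed.

End FreeMap.

(* The annihilator of R, a subspace of V (x) V, inside V^* (x) V^*; both spaces are
   given in coordinates, with respect to dual bases of V and V^*. *)
Definition perp (k : fieldType) (n : nat) (R : {vspace 'M[k]_n}) : set 'M[k]_n :=
  [set f | forall r, r \in R -> \sum_i \sum_j f i j * r i j = 0].

Section CoactionRel.
Variables (k : fieldType) (n : nat) (R : {vspace 'M[k]_n}) (B A : algType k).
Variables (z : 'I_n -> 'I_n -> B) (x : 'I_n -> A).

Lemma coaction_rel :
  (forall f r, perp R f -> r \in R ->
     \sum_a \sum_b \sum_c \sum_d (f a b * r c d) *: (z c a * z d b) = 0) ->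
  (forall r, r \in R -> \sum_a \sum_b r a b *: (x a * x b) = 0) ->
  forall r, r \in R ->
  \sum_c \sum_d r c d *: ((\sum_a tens (z c a) (x a)) *
                          (\sum_b tens (z d b) (x b))) = 0 :> tensor B A.
Proof.
move=> zR xR r rR; pose C a b := \sum_c \sum_d r c d *: (z c a * z d b).
have tZl (c : k) (b : B) (a : A) : tens (c *: b) a = c *: tens b a by exact: tensZl.
have tZr (c : k) (b : B) (a : A) : tens b (c *: a) = c *: tens b a by exact: tensZr.
have t0l (a : A) : tens (0 : B) a = 0 by rewrite -(scale0r 0) tZl scale0r.
have t0r (b : B) : tens b (0 : A) = 0 by rewrite -(scale0r 0) tZr scale0r.
have tsl I (s : seq I) (F : I -> B) (a : A) :
    tens (\sum_(i <- s) F i) a = \sum_(i <- s) tens (F i) a.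
  elim/big_ind2: _ => [|u u' v v' <- <-|//]; first exact: t0l.
  by rewrite tensDl.
have tsr I (s : seq I) (F : I -> A) (b : B) :
    tens b (\sum_(i <- s) F i) = \sum_(i <- s) tens b (F i).
  elim/big_ind2: _ => [|u u' v v' <- <-|//]; first exact: t0r.
  by rewrite tensDr.
have fC f : perp R f -> \sum_a \sum_b f a b *: C a b = 0.
  move=> fR; rewrite -[RHS](zR f r fR rR); apply: eq_bigr => a _.
  apply: eq_bigr => b _; rewrite scaler_sumr; apply: eq_bigr => c _.
  by rewrite scaler_sumr; apply: eq_bigr => d _; rewrite scalerA.
pose P c d : 'M[k]_n := projv R (delta_mx c d).
have projE (m : 'M[k]_n) a b :
    (projv R m) a b = \sum_c \sum_d m c d * P c d a b.
  rewrite {1}(matrix_sum_delta m) linear_sum summxE; apply: eq_bigr => c _.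
  rewrite linear_sum summxE; apply: eq_bigr => d _.
  by rewrite linearZ mxE.
have CE a b : C a b = \sum_c \sum_d P c d a b *: C c d.
  pose f : 'M[k]_n := \matrix_(c, d) ((delta_mx a b : 'M[k]_n) c d - P c d a b).
  have sumd (V : lmodType k) (F : 'I_n -> 'I_n -> V) :
      \sum_c \sum_d (delta_mx a b : 'M[k]_n) c d *: F c d = F a b.
    rewrite (bigD1 a) //= (bigD1 b) //= mxE !eqxx scale1r.
    rewrite big1 ?addr0 => [|d /negPf nd]; last by rewrite mxE nd andbF scale0r.
    rewrite big1 ?addr0 // => c /negPf nc; rewrite big1 // => d _.
    by rewrite mxE nc scale0r.
  have /fC : perp R f.
    move=> m mR; have := projE m a b; rewrite projv_id // => mE.
    have := sumd k^o (fun c d => m c d); rewrite mE => /eqP; rewrite -subr_eq0 => /eqP.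
    rewrite -sumrB => h; rewrite -[RHS]h; apply: eq_bigr => c _.
    rewrite -sumrB; apply: eq_bigr => d _.
    by rewrite /f mxE mulrBl [P c d a b * _]mulrC.
  move/eqP; rewrite -[X in X == _]addr0 => h; apply/eqP; rewrite -subr_eq0; move: h.
  rewrite addr0; congr (_ == _); rewrite -[C a b in RHS](sumd _ C) -sumrB.
  apply: eq_bigr => c _; rewrite -sumrB; apply: eq_bigr => d _.
  by rewrite [f c d]mxE scalerBl.
transitivity (\sum_a \sum_b tens (C a b) (x a * x b)).
  transitivity (\sum_c \sum_d \sum_a \sum_b r c d *: tens (z c a * z d b) (x a * x b)).
    apply: eq_bigr => c _; apply: eq_bigr => d _.
    rewrite mulr_suml scaler_sumr; apply: eq_bigr => a _.
    rewrite mulr_sumr scaler_sumr; apply: eq_bigr => b _.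
    by rewrite tensM.
  rewrite pair_bigA exchange_big; apply: eq_bigr => a _ /=.
  rewrite exchange_big; apply: eq_bigr => b _ /=.
  rewrite -(pair_bigA _ (fun c d => r c d *: tens (z c a * z d b) (x a * x b))) /=.
  rewrite tsl; apply: eq_bigr => c _; rewrite tsl; apply: eq_bigr => d _.
  by rewrite tZl.
transitivity (\sum_c \sum_d \sum_a \sum_b P c d a b *: tens (C c d) (x a * x b)).
  rewrite [RHS]pair_bigA [RHS]exchange_big; apply: eq_bigr => a _ /=.
  rewrite [RHS]exchange_big; apply: eq_bigr => b _ /=.
  rewrite -(pair_bigA _ (fun c d => P c d a b *: tens (C c d) (x a * x b))) /=.
  rewrite {1}CE tsl; apply: eq_bigr => c _; rewrite tsl; apply: eq_bigr => d _.
  by rewrite tZl.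
rewrite big1 // => c _; rewrite big1 // => d _; rewrite -[RHS](t0r (C c d)).
rewrite -(xR (P c d)) ?memv_proj // tsr; apply: eq_bigr => a _.
by rewrite tsr; apply: eq_bigr => b _; rewrite tZr.
Qed.
End CoactionRel.

Lemma sum_pair_pair (V : nmodType) (I : finType) (F : I * I -> I * I -> V) :
  \sum_(p : (I * I) * (I * I)) F p.1 p.2 =
  \sum_a \sum_b \sum_c \sum_d F (a, c) (b, d).
Proof.
rewrite -(pair_bigA _ F) /=.
have h (G : I * I -> V) : \sum_p G p = \sum_a \sum_c G (a, c).
  by rewrite pair_bigA; apply: eq_bigr => -[].
rewrite h; apply: eq_bigr => a _; rewrite [RHS]exchange_big; apply: eq_bigr => c _ /=.
by rewrite h.
Qed.

(* The relations of the quadratic algebra A = T(V)/(R): V is k^n with its standard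
   basis x_i, and a matrix r stands for \sum_(i, j) r i j x_i (x) x_j. *)
Definition qrel (k : fieldType) (n : nat) (R : {vspace 'M[k]_n}) :
    set ('I_n -> 'I_n -> k) :=
  [set s | exists2 r, r \in R & s = fun_of_matrix r].

Notation qalg R := (quadalg (qrel R)).

(* The basis element x^a (x) x_c of V^* (x) V has index (a, c), and S23 maps
   (x^a (x) x^b) (x) (x_c (x) x_d) to (x^a (x) x_c) (x) (x^b (x) x_d). *)
Definition S23 (k : fieldType) (n : nat) (f r : 'M[k]_n) (p q : 'I_n * 'I_n) : k :=
  f p.1 q.1 * r p.2 q.2.

Definition endrel (k : fieldType) (n : nat) (R : {vspace 'M[k]_n}) :
    set ('I_n * 'I_n -> 'I_n * 'I_n -> k) :=
  [set s | exists f r, [/\ perp R f, r \in R & s = S23 f r]].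

Notation endalg R := (quadalg (endrel R)).

Section QuadraticAlgebra.
Variables (k : fieldType) (n : nat) (R : {vspace 'M[k]_n}).
Local Notation qalg := (qalg R).
Local Notation endalg := (endalg R).

Definition qx (i : 'I_n) : qalg := qa_pi _ (gen k i).

(* endz i j is the generator z_i^j, the image of x^j (x) x_i. *)
Definition endz (i j : 'I_n) : endalg := qa_pi _ (gen k (j, i)).

Definition coact_tensor : freealg k 'I_n -> tensor endalg (freealg k 'I_n) :=
  free_map (fun i => \sum_j tens (endz i j) (gen k j)).

Definition coact_free : freealg k 'I_n -> tensor endalg qalg :=
  free_map (fun i => \sum_j tens (endz i j) (qx j)).

(* qlift evaluates coact_free on a representative; the value does not depend on
   it, by coact_algE. *)
Definition coact_alg : qalg -> tensor endalg qalg := qlift coact_free.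

Lemma quadalg_rel (X : finType) (S : set (X -> X -> k)) r : S r ->
  \sum_(p : X * X) r p.1 p.2 *: (qa_pi S (gen k p.1) * qa_pi S (gen k p.2)) = 0.
Proof.
move=> Sr; have pi0 : qa_pi S 0 = 0 by exact: qpi0.
transitivity (qa_pi S (quadelt r)).
  rewrite /quadelt; apply: esym; elim/big_rec2: _ => [//|p y x _ <-].
  by rewrite qa_pi_linear qa_piM.
rewrite -pi0; apply/qpi_eq; rewrite subr0; apply: lspan_mem.
by exists 1, (quadelt r), 1; rewrite mul1r mulr1; split=> //; exists r.
Qed.

Lemma coact_free_rel r : r \in R -> coact_free (quadelt r) = 0.
Proof.
move=> rR; rewrite /coact_free; set f := fun i : 'I_n => _.
have := free_map_linear f; have := free_map_gen f; have := free_mapM f.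
move: (free_map f) => g gM gG gL.
have g0 : g 0 = 0 by have := gL (-1) 0 0; rewrite scaler0 addr0 scaleN1r addNr.
have -> : g (quadelt r) = \sum_p r p.1 p.2 *: (f p.1 * f p.2).
  rewrite /quadelt; elim/big_rec2: _ => [//|p x y _ <-].
  by rewrite gL gM !gG.
rewrite -(pair_bigA _ (fun c d => r c d *: (f c * f d))) /=.
apply: (coaction_rel (R := R)) => // [h m hR mR|m mR].
  have hm : endrel R (S23 h m).
    by exists h, m.
  apply: etrans (quadalg_rel hm); symmetry.
  exact: (sum_pair_pair (fun p q => S23 h m p q *:
            (qa_pi _ (gen k p) * qa_pi _ (gen k q)))).
have mS : qrel R (fun_of_matrix m).
  by exists m.
by rewrite -[RHS](quadalg_rel mS) pair_bigA.
Qed.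

Lemma coact_algE p : coact_alg (qa_pi _ p) = coact_free p.
Proof.
apply: qliftE => [|x]; first exact: free_map_linear.
case=> a [s [b [[r [m mR ->] <-] ->]]].
by rewrite /coact_free !free_mapM [X in _ * X * _]coact_free_rel // mulr0 mul0r.
Qed.

Lemma coact_alg_linear : linear coact_alg.
Proof.
move=> a x y; rewrite -(qreprK x) -(qreprK y) -[qpi _ _]/(qa_pi _ _).
rewrite -[qpi _ (qrepr y)]/(qa_pi _ _) -qa_pi_linear !coact_algE.
exact: free_map_linear.
Qed.

Lemma coact_algM x y : coact_alg (x * y) = coact_alg x * coact_alg y.
Proof.
rewrite -(qreprK x) -(qreprK y) -[qpi _ _]/(qa_pi _ _).
rewrite -[qpi _ (qrepr y)]/(qa_pi _ _) -qa_piM !coact_algE.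
exact: free_mapM.
Qed.

Lemma coact_alg1 : coact_alg 1 = 1.
Proof. by rewrite -qa_pi1 coact_algE [LHS]free_map1. Qed.

Lemma coact_alg_x i : coact_alg (qx i) = \sum_j tens (endz i j) (qx j).
Proof. by rewrite coact_algE [LHS]free_map_gen. Qed.

(* The linear dual of the component of degree m of the quadratic dual of A, i.e. the
   annihilator of the degree m part of the ideal generated by the annihilator of R;
   it is the intersection of the V^i (x) R (x) V^j, i + 2 + j = m, in T(V). *)
Definition koszul_dual (m : nat) : set (freealg k 'I_n) :=
  [set u | freealg_deg m u /\
    forall i j, (i + 2 + j)%N = m ->
      lspan [set v | exists p r q, [/\ freealg_deg i p, r \in R,
                                      freealg_deg j q & v = p * quadelt r * q]] u].

(* The term of bidegree (m, j) of the Koszul complex, inside T(V) (x) A. *)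
Definition koszul_term (m j : nat) : set (tensor (freealg k 'I_n) qalg) :=
  lspan [set x | exists u a, [/\ koszul_dual m u, quadalg_deg j a & x = tens u a]].

(* (w x_i) (x) a |-> w (x) (x_i a) on words, and 1 (x) a |-> 0. *)
Definition koszul_diff_word (w : seq 'I_n) (a : qalg) :
    tensor (freealg k 'I_n) qalg :=
  if w is i :: s then tens (word k (belast i s)) (qx (last i s) * a) else 0.

Definition koszul_diff :
    tensor (freealg k 'I_n) qalg -> tensor (freealg k 'I_n) qalg :=
  tlift (fun (u : freealg k 'I_n) a =>
           \sum_(w <- msupp u) u@_w *: koszul_diff_word w a).

(* The image in bidegree (m, j) of the differential, which comes from bidegree
   (m + 1, j - 1). *)
Definition koszul_im (m j : nat) : set (tensor (freealg k 'I_n) qalg) :=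
  if j is j'.+1 then koszul_diff @` koszul_term m.+1 j' else [set 0].

Definition koszul : Prop :=
  forall l m j, (0 < l)%N -> (m + j)%N = l ->
  koszul_term m j `&` [set x | koszul_diff x = 0] = koszul_im m j.

End QuadraticAlgebra.

Section Character.
Variables (k : fieldType) (B : algType k) (M : lmodType k).

Definition is_basis (W : set M) (d : nat) (v : 'I_d -> M) : Prop :=
  (forall i, W (v i)) /\
  forall x, W x -> exists! c : 'rV[k]_d, x = \sum_i c 0 i *: v i.

(* Intended for a finite-dimensional subspace W that delta maps into B (x) W. *)
Definition is_character (delta : M -> tensor B M) (W : set M) (chi : B) : Prop :=
  exists (d : nat) (v : 'I_d -> M) (b : 'M[B]_d),
    [/\ is_basis W v,
        forall j, delta (v j) = \sum_i tens (b i j) (v i) &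
        chi = \sum_i b i i].

(* The default value 0 of xget is irrelevant: a finite-dimensional subcomodule
   has a character, and only one. *)
Definition character (delta : M -> tensor B M) (W : set M) : B :=
  xget 0 (is_character delta W).

End Character.

(* The power series ring B[[t]], t central; a series is its coefficient sequence. *)
Definition pseries (B : nzRingType) := nat -> B.

Definition ps_mul (B : nzRingType) (f g : pseries B) : pseries B :=
  fun d => \sum_(i < d.+1) f i * g (d - i)%N.

Definition ps_one (B : nzRingType) : pseries B := fun d => (d == 0%N)%:R.

(* The characters of A_l and of the dual of the component of degree m of A^!. *)
Definition char_alg (k : fieldType) (n : nat) (R : {vspace 'M[k]_n}) (l : nat) :
  endalg R := character (@coact_alg k n R) (quadalg_deg l).

Definition char_dual (k : fieldType) (n : nat) (R : {vspace 'M[k]_n}) (m : nat) :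
  endalg R := character (@coact_tensor k n R) (koszul_dual R m).

(* Main.v *)
Require Import Defs.
From HB Require Import structures.
From mathcomp Require Import all_boot all_order all_algebra finmap.
From mathcomp Require Import boolp classical_sets.
From mathcomp.multinomials Require Import monalg.

(* The Koszul complex in total degree l is a complex of left B-comodules; the character
   of the term of bidegree (m, l - m) is chi_{A^!*_m} chi_{A_{l-m}}, the coaction on a
   tensor product being diagonal.  Characters are additive on short exact sequences of
   finite-dimensional comodules, so exactness makes the alternating sum of these
   products vanish for l > 0: the series of the chi_{A_l} has a left inverse.  As its
   constant coefficient is 1, this left inverse is also a right inverse.

   Linear algebra over B (x) M rests on two facts: an independent family has
   dual functionals (Zorn), and every tensor is a sum of b_i (x) m_i with the b_i
   independent.  The second one shows that kernels and intersections of subcomodules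
   are subcomodules. *)

Set Implicit Arguments.
Unset Strict Implicit.
Unset Printing Implicit Defensive.

Import GRing.Theory.
Local Open Scope ring_scope.
Local Open Scope classical_set_scope.

(** * Subspaces, separating functionals and finite bases *)

Section Subspaces.
Variables (k : fieldType) (M : lmodType k).
Implicit Types (P W : set M) (x y : M).

Definition subspace W : Prop :=
  W 0 /\ forall a x y, W x -> W y -> W (a *: x + y).

Lemma subspace_lspan P : subspace (lspan P).
Proof.
split=> [|a x y Px Py]; first exact: lspan0.
by apply: lspan_add => //; apply: lspan_scale.
Qed.

Lemma lspan_min P W : subspace W -> P `<=` W -> lspan P `<=` W.
Proof. by move=> [W0 WD] PW x; elim=> [//|a u v /PW Wu _ Wv]; apply: WD. Qed.

Lemma lspan_mono P W : P `<=` W -> lspan P `<=` lspan W.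
Proof.
move=> PW; apply: lspan_min; first exact: subspace_lspan.
by move=> x /PW; apply: lspan_mem.
Qed.

Lemma subspace_sum W (I : Type) (s : seq I) (p : pred I) (c : I -> k) (v : I -> M) :
  subspace W -> (forall i, p i -> W (v i)) -> W (\sum_(i <- s | p i) c i *: v i).
Proof.
move=> [W0 WD] Wv; elim/big_rec: _ => [//|i x pi Wx].
by apply: WD => //; apply: Wv.
Qed.

Lemma subspaceI W1 W2 : subspace W1 -> subspace W2 -> subspace (W1 `&` W2).
Proof.
move=> [? h1] [? h2]; split=> // a x y [? ?] [? ?].
by split; [apply: h1 | apply: h2].
Qed.

Lemma lspan_setU1 P y x :
  lspan (P `|` [set y]) x -> exists c : k, lspan P (x - c *: y).
Proof.
elim=> [|a u v Pu _ [c Pc]]; first by exists 0; rewrite scale0r subr0; apply: lspan0.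
case: Pu => [Pu|->].
  by exists c; rewrite -addrA; apply: lspanD.
exists (a + c); suff -> : a *: y + v - (a + c) *: y = v - c *: y by [].
by rewrite scalerDl opprD addrACA subrr add0r.
Qed.

(* S is a maximal subspace that contains P and not x; then M = S (+) k x. *)
Lemma lspan_separation P x : ~ lspan P x ->
  exists g : {scalar M}, (forall w, P w -> g w = 0) /\ g x = 1.
Proof.
move=> Px.
have [|A [Ax Amax]] := @Zorn_bigcup M (fun X => ~ lspan (P `|` X) x).
  move=> F FP totF Fx.
  (* A combination uses finitely many vectors, so one member of the chain carries all of them;
     [set0] covers combinations of vectors of [P] alone. *)
  have : exists X, (F X \/ X = set0) /\ lspan (P `|` X) x.
    elim: Fx => [|a u v hu _ [X [hX Xv]]].
      by exists set0; split; [right | apply: lspan0].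
    case: hu => [Pu|[Y FY Yu]].
      by exists X; split=> //; apply: lspanD => //; left.
    case: hX => [FX|X0]; last first.
      exists Y; split; first by left.
      apply: lspanD; first by right.
      by apply: lspan_mono Xv; rewrite X0 setU0; apply: subsetUl.
    have [YX|XY] := totF _ _ FY FX.
      by exists X; split; [left | apply: lspanD => //; right; apply: YX].
    exists Y; split; first by left.
    by apply: lspanD; [right | apply: lspan_mono Xv; apply: setUS].
  case=> X [[FX|->]]; first exact: FP.
  by rewrite setU0.
pose S := lspan (P `|` A).
have [S0 SD] : subspace S by exact: subspace_lspan.
have dec y : exists c : k, S (y - c *: x).
  have [Sy|Sy] := pselect (S y); first by exists 0; rewrite scale0r subr0.
  (* By maximality, adding [y] outside [S] puts [x] in the span: [x - c *: y] lies in [S], and [c]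
     is nonzero because [x] is not in [S]. *)
  have : lspan (P `|` A `|` [set y]) x.
    apply: contrapT; rewrite -setUA; apply: (Amax (A `|` [set y])).
    rewrite properEneq; split; last exact: subsetUl.
    apply/eqP => AE; apply: Sy; apply: lspan_mem; right; rewrite AE.
    by right.
  case/lspan_setU1=> c Sc.
  have c0 : c != 0.
    by apply/eqP=> c0; apply: Ax; move: Sc; rewrite c0 scale0r subr0.
  exists c^-1; have := SD (- c^-1) _ _ Sc S0; rewrite addr0 scalerBr scalerA.
  by rewrite mulNr mulVf // !scaleNr scale1r opprK addrC.
have uniq y (c d : k) : S (y - c *: x) -> S (y - d *: x) -> c = d.
  move=> Sc Sd; apply/eqP; rewrite -subr_eq0; apply/eqP; apply: contrapT.
  move=> /eqP cd; apply: Ax.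
  have := SD (c - d)^-1 _ _ (SD (-1) _ _ Sc Sd) S0; rewrite addr0 scaleN1r.
  rewrite opprB addrA addrNK -scalerBl scalerA mulVf ?scale1r //.
pose g y : k^o := projT1 (cid (dec y)).
have gP y : S (y - g y *: x) by rewrite /g; case: cid.
have gL : linear g.
  move=> a y z; apply: (uniq (a *: y + z)); first exact: gP.
  have := SD a _ _ (gP y) (gP z); congr S.
  by rewrite scalerBr scalerA scalerDl opprD addrACA.
pose gM := GRing.isLinear.Build k M k *%R g gL.
pose gl : {scalar M} := HB.pack g gM.
exists gl; split=> [w Pw|]; apply: uniq (gP _) _.
  by rewrite scale0r subr0; apply: lspan_mem; left.
by rewrite scale1r subrr.
Qed.

Definition indep d (v : 'I_d -> M) : Prop :=
  forall c : 'I_d -> k, \sum_i c i *: v i = 0 -> forall i, c i = 0.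

(** Independence keeps [v i] outside the span of the other vectors, so [lspan_separation] gives a
    functional that is 1 on the former and 0 on the latter. *)
Lemma indep_dual d (v : 'I_d -> M) : indep v ->
  exists g : 'I_d -> {scalar M}, forall i j, g i (v j) = (i == j)%:R.
Proof.
move=> vI; suff h i : exists g : {scalar M}, forall j, g (v j) = (i == j)%:R.
  by exists (fun i => projT1 (cid (h i))) => i j; case: cid.
have [|g [gv gi]] := @lspan_separation [set v j | j in [set j | j != i]] (v i).
  move=> h.
  have : exists2 c : 'I_d -> k, c i = 0 & v i = \sum_j c j *: v j.
    elim: h => [|a u y [j /= ji <-] _ [c ci ->]].
      by exists (fun=> 0) => //; rewrite big1 // => j _; rewrite scale0r.
    exists (fun l => a * (l == j)%:R + c l).
      by rewrite eq_sym (negPf ji) mulr0 ci addr0.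
    under [RHS]eq_bigr do rewrite scalerDl.
    rewrite big_split; congr (_ + _); rewrite (bigD1 j) //= eqxx mulr1 big1 ?addr0 //.
    by move=> l /negPf ->; rewrite mulr0 scale0r.
  case=> c ci vE; have : \sum_j (c j - (j == i)%:R) *: v j = 0.
    under eq_bigr do rewrite scalerBl.
    rewrite sumrB -vE (bigD1 i) //= eqxx scale1r big1 ?addr0 ?subrr //.
    by move=> l /negPf ->; rewrite scale0r.
  move/vI/(_ i)/eqP; rewrite ci eqxx sub0r oppr_eq0.
  by apply/negP; rewrite oner_neq0.
exists g => j; have [<-|ij] := eqVneq i j; first by rewrite gi.
by rewrite gv //; exists j => //=; rewrite eq_sym.
Qed.

(** Otherwise the coordinate matrix would have a nonzero left kernel, and a row of that kernel is a
    linear relation among the [v i]. *)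
Lemma indep_size (I : finType) (w : I -> M) d (v : 'I_d -> M) : indep v ->
  (forall i, exists c : I -> k, v i = \sum_j c j *: w j) -> (d <= #|I|)%N.
Proof.
move=> vI vw; rewrite leqNgt; apply/negP => ltD.
have /choice[A vA] := vw.
pose B : 'M[k]_(d, #|I|) := \matrix_(i, j) A i (enum_val j).
have : kermx B != 0.
  rewrite -mxrank_eq0 mxrank_ker subn_eq0 -ltnNge.
  exact: leq_ltn_trans (rank_leq_col B) ltD.
apply/negP; rewrite negbK; apply/eqP/matrixP => l i; rewrite [RHS]mxE.
apply: (vI (fun i => kermx B l i)).
under eq_bigr do rewrite vA scaler_sumr.
rewrite exchange_big big1 // => j _ /=.
under eq_bigr do rewrite scalerA.
rewrite -scaler_suml.
have /matrixP/(_ l (enum_rank j)) := mulmx_ker B.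
rewrite [RHS]mxE mxE; under eq_bigr do rewrite [B _ _]mxE enum_rankK.
by move=> ->; rewrite scale0r.
Qed.

Lemma basis_indep W d (v : 'I_d -> M) : subspace W -> is_basis W v -> indep v.
Proof.
move=> [W0 _] [_ /(_ _ W0)[c0 [_ cU]]] c vc i.
have -> : c i = (\row_i c i) 0 i by rewrite mxE.
have -> : \row_i c i = 0.
  rewrite -[RHS](cU 0); last by rewrite big1 // => j _; rewrite mxE scale0r.
  by apply/esym/cU; rewrite -[LHS]vc; apply: eq_bigr => j _; rewrite mxE.
by rewrite mxE.
Qed.

Lemma indep_basis W d (v : 'I_d -> M) : indep v -> (forall i, W (v i)) ->
  (forall x, W x -> exists c : 'I_d -> k, x = \sum_i c i *: v i) -> is_basis W v.
Proof.
move=> vI Wv Wspan; split=> // x /Wspan[c xc].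
exists (\row_i c i); split=> [|c' xc'].
  by rewrite xc; apply: eq_bigr => i _; rewrite mxE.
apply/rowP => i; rewrite mxE; apply/eqP; rewrite -subr_eq0; apply/eqP.
apply: (vI (fun i => c i - c' 0 i)).
under eq_bigr do rewrite scalerBl.
by rewrite sumrB -xc -xc' subrr.
Qed.

Lemma basis_span W d (v : 'I_d -> M) x : is_basis W v -> W x ->
  exists c : 'I_d -> k, x = \sum_i c i *: v i.
Proof. by case=> _ h /h[c [xc _]]; exists (fun i => c 0 i). Qed.

(* A linearly independent family in W of maximal size. *)
Lemma subspace_basis W (I : finType) (w : I -> M) : subspace W ->
  (forall x, W x -> exists c : I -> k, x = \sum_i c i *: w i) ->
  exists (d : nat) (v : 'I_d -> M), is_basis W v.
Proof.
move=> subW Ww.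
pose P d := `[< exists v : 'I_d -> M, indep v /\ forall i, W (v i) >].
have P0 : exists d, P d.
  exists 0%N; apply/asboolP.
  have v : 'I_0 -> M by case.
  by exists v; split=> [c _|]; case.
have Pmax d : P d -> (d <= #|I|)%N.
  by move=> /asboolP[v [vI Wv]]; apply: indep_size vI _ => i; apply: Ww.
have := ex_maxnP P0 Pmax; case=> d /asboolP[v [vI Wv]] dmax.
exists d, v; apply: indep_basis => // x Wx; apply: contrapT => nx.
suff /dmax : P d.+1 by rewrite ltnn.
apply/asboolP; exists (fun i => if unlift ord0 i is Some j then v j else x).
split=> [c|i]; last by case: unliftP.
rewrite big_ord_recl unlift_none; under eq_bigr do rewrite liftK.
move=> h.
(* A nonzero coefficient at [x] would put [x] in the span of [v]. *)
have c0 : c ord0 = 0.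
  apply/eqP; apply: contrapT => /negP c0; apply: nx.
  exists (fun i => - (c ord0)^-1 * c (lift ord0 i)).
  move/eqP: h; rewrite addrC addr_eq0 => /eqP h.
  under eq_bigr do rewrite -scalerA.
  by rewrite -scaler_sumr h scalerN -scaleNr opprK scalerA mulVf // scale1r.
move: h; rewrite c0 scale0r add0r => /vI h i.
by case: (unliftP ord0 i) => [j ->|->].
Qed.

End Subspaces.

(** * Contractions and functoriality of the tensor product *)

Section TensorMaps.
Variables (k : fieldType) (B M : lmodType k).

Lemma tens0l (m : M) : tens (0 : B) m = 0.
Proof. by rewrite -(scale0r 0) tensZl scale0r. Qed.

Lemma tens0r (b : B) : tens b (0 : M) = 0.
Proof. by rewrite -(scale0r 0) tensZr scale0r. Qed.

Lemma tens_suml (I : Type) (s : seq I) (P : pred I) (F : I -> B) (m : M) :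
  tens (\sum_(i <- s | P i) F i) m = \sum_(i <- s | P i) tens (F i) m.
Proof.
elim/big_rec2: _ => [|i x y _ <-]; first exact: tens0l.
by rewrite tensDl.
Qed.

Lemma tens_sumr (I : Type) (s : seq I) (P : pred I) (b : B) (F : I -> M) :
  tens b (\sum_(i <- s | P i) F i) = \sum_(i <- s | P i) tens b (F i).
Proof.
elim/big_rec2: _ => [|i x y _ <-]; first exact: tens0r.
by rewrite tensDr.
Qed.

(** With [g] taken from a dual family, this reads off one coefficient in [M] of a tensor;
    [contract_r] does the same for coefficients in [B]. *)
Definition contract_l (g : {scalar B}) : tensor B M -> M :=
  tlift (fun b m => g b *: m).

Fact contract_l_bilin (g : {scalar B}) :
  (forall m : M, linear (fun b => g b *: m)) /\
  (forall b, linear (fun m : M => g b *: m)).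
Proof.
split=> [m a x y|b a x y].
  by rewrite linearP scalerDl scalerA.
by rewrite scalerDr !scalerA mulrC.
Qed.

Lemma contract_l_linear g : linear (contract_l g).
Proof. by have [h1 h2] := contract_l_bilin g; apply: tlift_linear. Qed.

HB.instance Definition _ g := GRing.isLinear.Build k (tensor B M) M _
  (contract_l g) (contract_l_linear g).

Lemma contract_lE g b m : contract_l g (tens b m) = g b *: m.
Proof.
have [h1 h2] := contract_l_bilin g.
exact: (tliftE (f := fun b m => g b *: m)).
Qed.

Definition contract_r (g : {scalar M}) : tensor B M -> B :=
  tlift (fun b m => g m *: b).

Fact contract_r_bilin (g : {scalar M}) :
  (forall m, linear (fun b : B => g m *: b)) /\
  (forall b : B, linear (fun m => g m *: b)).
Proof.
split=> [m a x y|b a x y].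
  by rewrite scalerDr !scalerA mulrC.
by rewrite linearP scalerDl scalerA.
Qed.

Lemma contract_r_linear g : linear (contract_r g).
Proof. by have [h1 h2] := contract_r_bilin g; apply: tlift_linear. Qed.

HB.instance Definition _ g := GRing.isLinear.Build k (tensor B M) B _
  (contract_r g) (contract_r_linear g).

Lemma contract_rE g b m : contract_r g (tens b m) = g m *: b.
Proof.
have [h1 h2] := contract_r_bilin g.
exact: (tliftE (f := fun b m => g m *: b)).
Qed.

Variable N : lmodType k.

Definition tens_map (f : {linear M -> N}) : tensor B M -> tensor B N :=
  tlift (fun b m => tens b (f m)).

Fact tens_map_bilin (f : {linear M -> N}) :
  (forall m, linear (fun b : B => tens b (f m))) /\
  (forall b : B, linear (fun m => tens b (f m))).
Proof.
split=> [m a x y|b a x y]; first by rewrite tensDl tensZl.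
by rewrite linearP tensDr tensZr.
Qed.

Lemma tens_map_linear f : linear (tens_map f).
Proof. by have [h1 h2] := tens_map_bilin f; apply: tlift_linear. Qed.

HB.instance Definition _ f := GRing.isLinear.Build k (tensor B M) (tensor B N) _
  (tens_map f) (tens_map_linear f).

Lemma tens_mapE f b m : tens_map f (tens b m) = tens b (f m).
Proof.
have [h1 h2] := tens_map_bilin f.
exact: (tliftE (f := fun b m => tens b (f m))).
Qed.

End TensorMaps.

(** * Tensors with the right factor in a subspace *)

Section TensorSubspaces.
Variables (k : fieldType) (B M : lmodType k).
Implicit Types (W : set M) (x : tensor B M).

Definition tens_sub W : set (tensor B M) :=
  lspan [set x | exists b w, W w /\ x = tens b w].

Lemma tens_sub_tens W b w : W w -> tens_sub W (tens b w).
Proof. by move=> Ww; apply: lspan_mem; exists b, w. Qed.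

Lemma tens_sub_sum W (I : Type) (s : seq I) (P : pred I) (F : I -> tensor B M) :
  (forall i, P i -> tens_sub W (F i)) -> tens_sub W (\sum_(i <- s | P i) F i).
Proof.
move=> WF; elim/big_rec: _ => [|i x Pi Wx]; first exact: lspan0.
by apply: lspan_add => //; apply: WF.
Qed.

(** An expression of [x] with the fewest terms works: a relation among the [b i] would eliminate one
    term. *)
Lemma tensor_indep x : exists (d : nat) (b : 'I_d -> B) (m : 'I_d -> M),
  indep b /\ x = \sum_i tens (b i) (m i).
Proof.
pose P d := `[< exists (b : 'I_d -> B) (m : 'I_d -> M), x = \sum_i tens (b i) (m i) >].
have exP : exists d, P d.
  suff [d [b [m xE]]] : exists d (b : 'I_d -> B) (m : 'I_d -> M),
      x = \sum_i tens (b i) (m i).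
    by exists d; apply/asboolP; exists b, m.
  elim/tensor_ind: x {P} => [|b0 m0 x [d [b [m ->]]]].
    exists 0%N, (fun=> 0), (fun=> 0); rewrite big_ord0 //.
  exists d.+1, (fun i => if unlift ord0 i is Some j then b j else b0),
    (fun i => if unlift ord0 i is Some j then m j else m0).
  rewrite big_ord_recl unlift_none; congr (_ + _).
  by apply: eq_bigr => i _; rewrite liftK.
have := ex_minnP exP; case=> d /asboolP[b [m xE]] dmin.
exists d, b, m; split=> // c cb i0; apply/eqP; apply: contrapT => /negP ci0.
case: d => [|d] in b m xE c cb i0 ci0 dmin *; first by case: i0 {ci0}.
suff /dmin : P d by rewrite ltnn.
apply/asboolP; exists (fun j => b (lift i0 j)),
  (fun j => m (lift i0 j) - ((c i0)^-1 * c (lift i0 j)) *: m i0).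
(* Subtracting a multiple of the relation tensored with [m i0], which is zero, makes the second
   factor at [i0] vanish. *)
have -> : x = \sum_i tens (b i) (m i - ((c i0)^-1 * c i) *: m i0).
  transitivity (x - (c i0)^-1 *: tens (\sum_i c i *: b i) (m i0)).
    by rewrite cb tens0l scaler0 subr0.
  rewrite {1}xE tens_suml scaler_sumr -sumrB; apply: eq_bigr => i _.
  by rewrite tensDr -[- (_ *: m i0)]scaleNr tensZr tensZl scaleNr scalerA.
rewrite (bigD1_ord i0) //=.
by rewrite mulVf // scale1r subrr tens0r add0r.
Qed.

(** Contraction with the functional dual to [b i] extracts [m i], and every contraction carries
    [tens_sub W] into [W]. *)
Lemma tens_sub_coef W d (b : 'I_d -> B) (m : 'I_d -> M) : subspace W -> indep b ->
  tens_sub W (\sum_i tens (b i) (m i)) -> forall i, W (m i).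
Proof.
move=> subW /indep_dual[g gb] Wx i.
have -> : m i = contract_l (g i) (\sum_i tens (b i) (m i)).
  rewrite linear_sum (bigD1 i) //= contract_lE gb eqxx scale1r big1 ?addr0 // => j ji.
  by rewrite contract_lE gb eq_sym (negPf ji) scale0r.
have [W0 WD] := subW.
elim: Wx => [|a u v [c [w [Ww ->]]] _ IH]; first by rewrite linear0.
rewrite linearP; apply: (WD) => //=; rewrite contract_lE -[_ *: w]addr0.
exact: WD.
Qed.

Lemma tens_sum_inj d (b b' : 'I_d -> B) (v : 'I_d -> M) : indep v ->
  \sum_i tens (b i) (v i) = \sum_i tens (b' i) (v i) -> b =1 b'.
Proof.
move=> /indep_dual[g gv] bb' i.
have h (c : 'I_d -> B) : c i = contract_r (g i) (\sum_i tens (c i) (v i)).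
  rewrite linear_sum (bigD1 i) //= contract_rE gv eqxx scale1r big1 ?addr0 // => j ji.
  by rewrite contract_rE gv eq_sym (negPf ji) scale0r.
by rewrite (h b) bb' -h.
Qed.

Lemma tens_sub_basis W d (v : 'I_d -> M) x : is_basis W v -> tens_sub W x ->
  exists b : 'I_d -> B, x = \sum_i tens (b i) (v i).
Proof.
move=> Wv; elim=> [|a u y [b [w [Ww ->]]] _ [c ->]].
  by exists (fun=> 0); rewrite big1 // => i _; rewrite tens0l.
have [e ->] := basis_span Wv Ww.
exists (fun i => (a * e i) *: b + c i); rewrite tens_sumr scaler_sumr -big_split.
apply: eq_bigr => i _ /=.
by rewrite tensDl tensZl tensZr scalerA.
Qed.

End TensorSubspaces.

Section TensorMapSubspaces.
Variables (k : fieldType) (B M N : lmodType k).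
Implicit Types (W : set M) (x : tensor B M).


Lemma tens_sub_map W (W' : set N) (f : {linear M -> N}) x :
  (forall w, W w -> W' (f w)) -> tens_sub W x -> tens_sub W' (tens_map f x).
Proof.
move=> fW; elim=> [|a u y [b [w [Ww ->]]] _ IH]; first by rewrite linear0; apply: lspan0.
rewrite linearP; apply: lspan_add => //; apply: lspan_scale => /=.
by rewrite tens_mapE; apply/tens_sub_tens/fW.
Qed.

(** Once [x] is written with independent [b i], membership and vanishing both pass to the
    coefficients in [M]. This is exactness of tensoring with [B] over a field. *)
Lemma tens_sub_ker W (f : {linear M -> N}) x : subspace W ->
  tens_sub W x -> tens_map f x = 0 -> tens_sub (W `&` [set m | f m = 0]) x.
Proof.
have [d [b [m [bI ->]]]] := tensor_indep x => subW /(tens_sub_coef subW bI) Wm.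
rewrite linear_sum /=; under eq_bigr do rewrite tens_mapE.
move=> f0; apply: tens_sub_sum => i _; apply: tens_sub_tens; split=> //=.
have sub0 : subspace [set x : N | x = 0].
  by split=> // a u v -> ->; rewrite scaler0 addr0.
(* With the zero subspace, [tens_sub_coef] turns vanishing of the sum into vanishing of each
   [f (m i)]. *)
apply: (tens_sub_coef (m := fun i => f (m i)) sub0 bI).
by rewrite f0; apply: lspan0.
Qed.

End TensorMapSubspaces.

(** * Characters: uniqueness, existence, additivity *)

Section Characters.
Variables (k : fieldType) (B : algType k).
Implicit Types M N : lmodType k.

(** For a coaction [delta] and a subspace [W], this says that [W] is a subcomodule. *)
Definition stable M (delta : M -> tensor B M) (W : set M) : Prop :=
  forall w, W w -> tens_sub W (delta w).

(** The two coefficient matrices are conjugate by a change of basis with entries in [k]; these are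
    central, so the trace is invariant even over a noncommutative [B]. *)
Lemma is_character_uniq M (delta : {linear M -> tensor B M}) (W : set M) chi chi' :
  subspace W -> is_character delta W chi -> is_character delta W chi' -> chi = chi'.
Proof.
move=> subW [d [v [b [vB bE ->]]]] [d' [v' [b' [vB' bE' ->]]]].
have vI := basis_indep subW vB; have vI' := basis_indep subW vB'.
have /choice[P PE] : forall j, exists c : 'I_d -> k, v' j = \sum_i c i *: v i.
  by move=> j; apply: basis_span vB _; apply: vB'.1.
have /choice[Q QE] : forall j, exists c : 'I_d' -> k, v j = \sum_i c i *: v' i.
  by move=> j; apply: basis_span vB' _; apply: vB.1.
have PQ l i : \sum_m Q l m * P m i = (i == l)%:R.
  apply/eqP; rewrite -subr_eq0; apply/eqP.
  apply: (vI (fun i => \sum_m Q l m * P m i - (i == l)%:R)).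
  under eq_bigr do rewrite scalerBl scaler_suml.
  rewrite sumrB [X in _ - X](bigD1 l) //= eqxx scale1r [X in _ - (_ + X)]big1.
    rewrite addr0 [X in _ - X]QE exchange_big -sumrB big1 // => m _ /=.
    rewrite PE scaler_sumr; apply/eqP; rewrite subr_eq0; apply/eqP.
    by apply: eq_bigr => j _; rewrite scalerA.
  by move=> j /negPf ->; rewrite scale0r.
(* Expand [delta (v' j)] through [v], return to [v'], and compare coefficients along [v']. *)
have b'E j m : b' m j = \sum_i \sum_l (P j i * Q l m) *: b l i.
  move: m; apply: (tens_sum_inj vI'); rewrite -bE' PE linear_sum.
  under [RHS]eq_bigr do rewrite tens_suml.
  rewrite [RHS]exchange_big; apply: eq_bigr => i _; rewrite linearZ /= bE.
  under [RHS]eq_bigr do rewrite tens_suml.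
  rewrite [RHS]exchange_big scaler_sumr; apply: eq_bigr => l _ /=.
  rewrite QE tens_sumr scaler_sumr; apply: eq_bigr => m _.
  by rewrite tensZr tensZl scalerA.
under [RHS]eq_bigr do rewrite b'E.
rewrite exchange_big; apply: eq_bigr => i _ /=; rewrite exchange_big /=.
transitivity (\sum_l (i == l)%:R *: b l i).
  rewrite (bigD1 i) //= eqxx scale1r big1 ?addr0 // => l /negPf.
  by rewrite eq_sym => ->; rewrite scale0r.
apply: eq_bigr => l _; rewrite -scaler_suml -PQ; congr (_ *: _).
by apply: eq_bigr => m _; rewrite mulrC.
Qed.

Lemma characterE M (delta : {linear M -> tensor B M}) (W : set M) chi :
  subspace W -> is_character delta W chi -> character delta W = chi.
Proof.
move=> subW chiW; rewrite /character; apply: xget_unique; first exact: chiW.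
by move=> y chiy; apply: is_character_uniq chiy chiW.
Qed.

(** Allows bases indexed by a sum, a product or the unit type, where [is_character] asks for an
    ordinal. *)
Lemma is_character_fin M (delta : M -> tensor B M) (W : set M) (I : finType)
    (v : I -> M) (b : I -> I -> B) :
  (forall i, W (v i)) ->
  (forall c : I -> k, \sum_i c i *: v i = 0 -> forall i, c i = 0) ->
  (forall x, W x -> exists c : I -> k, x = \sum_i c i *: v i) ->
  (forall j, delta (v j) = \sum_i tens (b i j) (v i)) ->
  is_character delta W (\sum_i b i i).
Proof.
have E (V : nmodType) (F : I -> V) : \sum_i F i = \sum_(i < #|I|) F (enum_val i).
  by rewrite (reindex _ (onW_bij _ (enum_val_bij I))).
move=> Wv vI Wspan bE.
exists #|I|, (fun i => v (enum_val i)), (\matrix_(i, j) b (enum_val i) (enum_val j)).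
split=> [|j|]; last by rewrite E; apply: eq_bigr => i _; rewrite mxE.
  apply: indep_basis => // [c c0 i|x /Wspan[c ->]]; last first.
    by exists (fun i => c (enum_val i)); rewrite E.
  rewrite -(enum_valK i); apply: (vI (fun i => c (enum_rank i))).
  by rewrite E -[RHS]c0; apply: eq_bigr => j _; rewrite enum_valK.
by rewrite bE E; apply: eq_bigr => i _; rewrite mxE.
Qed.

(** The family [w], which may lie outside [W], bounds the dimension; stability then gives the
    coefficient matrix on a basis of [W]. *)
Lemma is_character_stable M (delta : M -> tensor B M) (W : set M) (I : finType)
    (w : I -> M) :
  subspace W -> stable delta W ->
  (forall x, W x -> exists c : I -> k, x = \sum_i c i *: w i) ->
  exists chi, is_character delta W chi.
Proof.
move=> subW dW Ww; have [d [v vB]] := subspace_basis subW Ww.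
have /choice[b bE] : forall j, exists b : 'I_d -> B, delta (v j) = \sum_i tens (b i) (v i).
  by move=> j; apply: (tens_sub_basis vB); apply/dW/vB.1.
exists (\sum_i b i i), d, v, (\matrix_(i, j) b j i).
split=> // [j|]; last by apply: eq_bigr => i _; rewrite mxE.
by rewrite bE; apply: eq_bigr => i _; rewrite mxE.
Qed.

(* A basis of the kernel followed by lifts of a basis of the image is a basis of W
   in which delta is block triangular. *)
Lemma is_character_exact M N (deltaM : {linear M -> tensor B M})
    (deltaN : N -> tensor B N) (f : {linear M -> N}) (W : set M) chi' chi'' :
  subspace W -> stable deltaM W ->
  (forall x, W x -> tens_map f (deltaM x) = deltaN (f x)) ->
  is_character deltaM (W `&` [set x | f x = 0]) chi' ->
  is_character deltaN (f @` W) chi'' ->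
  is_character deltaM W (chi' + chi'').
Proof.
move=> subW dW fd [d [v [b [vB bE ->]]]] [e [u [c [uB cE ->]]]].
have subK : subspace [set x | f x = 0].
  split=> [|a x y /= x0 y0]; first by rewrite /= linear0.
  by rewrite linearP /= x0 y0 scaler0 addr0.
have subf : subspace (f @` W).
  have [W0 WD] := subW.
  split=> [|a _ _ [x Wx <-] [y Wy <-]]; first by exists 0; rewrite ?linear0.
  by exists (a *: x + y); [apply: WD | rewrite linearP].
have vI := basis_indep (subspaceI subW subK) vB; have uI := basis_indep subf uB.
have /choice[w wE] : forall j, exists x, W x /\ f x = u j.
  by move=> j; have [x Wx <-] := uB.1 j; exists x.
have Wv i : W (v i) by have [] := vB.1 i.
have fv i : f (v i) = 0 by have [] := vB.1 i.
(* The lift [w j] follows the matrix [c] up to an error. [tens_map f] kills this error, so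
   [tens_sub_ker] places it over the kernel, where it expands along [v]. *)
have /choice[a aE] : forall j, exists a : 'I_d -> B,
    deltaM (w j) - \sum_i tens (c i j) (w i) = \sum_i tens (a i) (v i).
  move=> j; apply: tens_sub_basis vB _; apply: tens_sub_ker => //.
    rewrite -scaleN1r addrC; apply: lspan_add; last by apply/dW/(wE j).1.
    by apply/lspan_scale/tens_sub_sum => i _; apply/tens_sub_tens/(wE i).1.
  rewrite linearB /= fd; last exact: (wE j).1.
  rewrite (wE j).2 cE (linear_sum (tens_map f)) /=; apply/eqP; rewrite subr_eq0; apply/eqP.
  by apply: eq_bigr => i _; rewrite tens_mapE (wE i).2.
pose h (i j : 'I_d + 'I_e) : B := match i, j with
  | inl i, inl j => b i j | inl i, inr j => a j i
  | inr i, inr j => c i j | inr i, inl j => 0 end.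
have -> : \sum_i b i i + \sum_i c i i = \sum_i h i i by rewrite big_sumType.
apply: (is_character_fin (v := fun i => match i with inl i => v i | inr i => w i end)).
- by case=> i //; exact: (wE i).1.
- move=> g; rewrite big_sumType /= => g0.
  (* Applying [f] removes the kernel part and leaves a relation among the [u i]. *)
  have gw i : g (inr i) = 0.
    apply: (uI (fun i => g (inr i))); have := congr1 f g0.
    rewrite linearD !linear_sum /= linear0 big1 ?add0r => [fg0|j _].
      rewrite -[RHS]fg0; apply: eq_bigr => j _.
      by rewrite linearZ /= (wE j).2.
    by rewrite linearZ /= fv scaler0.
  case=> [i|//]; apply: (vI (fun i => g (inl i))).
  by rewrite -[RHS]g0 [X in _ + X]big1 ?addr0 // => j _; rewrite gw scale0r.
- move=> x Wx; have [r rE] : exists r : 'I_e -> k, f x = \sum_i r i *: u i.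
    by apply: basis_span uB _; exists x.
  have [|g gE] := basis_span (x := x - \sum_i r i *: w i) vB.
    split=> /=.
      rewrite -scaleN1r addrC; apply: subW.2 => //.
      by apply: subspace_sum => // i _; exact: (wE i).1.
    rewrite linearB linear_sum /= rE; apply/eqP; rewrite subr_eq0; apply/eqP.
    by apply: eq_bigr => i _; rewrite linearZ /= (wE i).2.
  exists (fun i => match i with inl i => g i | inr i => r i end).
  by rewrite big_sumType /= -gE subrK.
case=> j; rewrite big_sumType /=.
  by rewrite bE [X in _ + X]big1 ?addr0 // => i _; rewrite tens0l.
by rewrite -aE subrK.
Qed.

End Characters.

(** * The diagonal coaction on a tensor product *)

Lemma sum_pair (V : nmodType) (I J : finType) (F : I * J -> V) :
  \sum_p F p = \sum_i \sum_j F (i, j).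
Proof. by rewrite pair_bigA; apply: eq_bigr => -[]. Qed.

Section Diagonal.
Variables (k : fieldType) (B : algType k) (U A : lmodType k).
Local Notation BUA := (tensor B (tensor U A)).

Definition tens_pair1 (b : B) (u : U) : tensor B A -> BUA :=
  tlift (fun b' a => tens (b * b') (tens u a)).

Fact tens_pair1_bilin b u :
  (forall a : A, linear (fun b' => tens (b * b') (tens u a) : BUA)) /\
  (forall b', linear (fun a : A => tens (b * b') (tens u a) : BUA)).
Proof.
split=> [a c x y|b' c x y]; first by rewrite mulrDr -scalerAr tensDl tensZl.
by rewrite !(tensDr, tensZr).
Qed.

Lemma tens_pair1_linear b u : linear (tens_pair1 b u).
Proof. by have [h1 h2] := tens_pair1_bilin b u; apply: tlift_linear. Qed.

HB.instance Definition _ b u := GRing.isLinear.Build k (tensor B A) BUA _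
  (tens_pair1 b u) (tens_pair1_linear b u).

Lemma tens_pair1E b u b' a : tens_pair1 b u (tens b' a) = tens (b * b') (tens u a).
Proof.
have [h1 h2] := tens_pair1_bilin b u.
exact: (tliftE (f := fun b' a => tens (b * b') (tens u a))).
Qed.

(* The right factor comes first: tens_pair (b' (x) a) (b (x) u) = b b' (x) (u (x) a). *)
Definition tens_pair (y : tensor B A) : tensor B U -> BUA :=
  tlift (fun b u => tens_pair1 b u y).

Fact tens_pair_bilin (y : tensor B A) :
  (forall u, linear (fun b => tens_pair1 b u y)) /\
  (forall b, linear (fun u => tens_pair1 b u y)).
Proof.
split=> [u|b] c p q; elim/tensor_ind: y => [|m n y IH].
- by rewrite !linear0 ?scaler0 ?addr0.
- rewrite !linearD /= IH !tens_pair1E mulrDl -scalerAl tensDl tensZl !addrA.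
  by congr (_ + _); rewrite addrAC.
- by rewrite !linear0 ?scaler0 ?addr0.
- rewrite !linearD /= IH !tens_pair1E tensDl tensZl tensDr tensZr !addrA.
  by congr (_ + _); rewrite addrAC.
Qed.

Lemma tens_pair_linear y : linear (tens_pair y).
Proof. by have [h1 h2] := tens_pair_bilin y; apply: tlift_linear. Qed.

HB.instance Definition _ y := GRing.isLinear.Build k (tensor B U) BUA _
  (tens_pair y) (tens_pair_linear y).

Lemma tens_pairU y b u : tens_pair y (tens b u) = tens_pair1 b u y.
Proof.
have [h1 h2] := tens_pair_bilin y.
exact: (tliftE (f := fun b u => tens_pair1 b u y)).
Qed.

Lemma tens_pairE b u b' a :
  tens_pair (tens b' a) (tens b u) = tens (b * b') (tens u a).
Proof. by rewrite tens_pairU tens_pair1E. Qed.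

Lemma tens_pair_linearr x : linear (tens_pair^~ x).
Proof.
move=> c p q; elim/tensor_ind: x => [|m n x IH].
  by rewrite !linear0 ?scaler0 ?addr0.
rewrite !linearD /= IH !tens_pairU linearP !addrA.
by congr (_ + _); rewrite addrAC.
Qed.

Lemma tens_pair_suml (J : finType) (G : J -> tensor B A) x :
  tens_pair (\sum_j G j) x = \sum_j tens_pair (G j) x.
Proof.
have h0 : tens_pair 0 x = 0.
  by have := tens_pair_linearr x (-1) 0 0; rewrite scaler0 addr0 scaleN1r addNr.
elim/big_rec2: _ => [//|j y z _ <-].
by have := tens_pair_linearr x 1 (G j) z; rewrite !scale1r.
Qed.

Variables (deltaU : {linear U -> tensor B U}) (deltaA : {linear A -> tensor B A}).

(** The diagonal coaction. Coefficients coming from [U] stand to the left of those from [A], which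
    fixes the order of the factors in products of characters. *)
Definition coact_tens : tensor U A -> BUA :=
  tlift (fun u a => tens_pair (deltaA a) (deltaU u)).

Fact coact_tens_bilin :
  (forall a, linear (fun u => tens_pair (deltaA a) (deltaU u))) /\
  (forall u, linear (fun a => tens_pair (deltaA a) (deltaU u))).
Proof.
split=> [a c x y|u c x y]; first by rewrite !linearP.
by rewrite linearP tens_pair_linearr.
Qed.

Lemma coact_tens_linear : linear coact_tens.
Proof. by have [h1 h2] := coact_tens_bilin; apply: tlift_linear. Qed.

HB.instance Definition _ := GRing.isLinear.Build k (tensor U A) BUA _
  coact_tens coact_tens_linear.

Lemma coact_tensE u a : coact_tens (tens u a) = tens_pair (deltaA a) (deltaU u).
Proof.
have [h1 h2] := coact_tens_bilin.
exact: (tliftE (f := fun u a => tens_pair (deltaA a) (deltaU u))).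
Qed.

Lemma coact_tens_map (f : {linear tensor U A -> tensor U A}) (P : set U) :
  (forall u, lspan P u) ->
  (forall u a, P u -> tens_map f (coact_tens (tens u a)) = coact_tens (f (tens u a))) ->
  forall x, tens_map f (coact_tens x) = coact_tens (f x).
Proof.
move=> Pspan fP; elim/tensor_ind => [|u a x IH]; first by rewrite !linear0.
rewrite !linearD /= IH; congr (_ + _).
elim: (Pspan u) => [|c v w Pv _ IHw]; first by rewrite tens0l !linear0.
by rewrite tensDl tensZl !linearP /= IHw fP.
Qed.

(** Shaped so that [koszul_term m j] is convertible to an instance of it. *)
Definition tens_prod (W : set U) (W' : set A) : set (tensor U A) :=
  lspan [set x | exists u a, [/\ W u, W' a & x = tens u a]].

Lemma tens_sub_pair (W : set U) (W' : set A) x y :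
  tens_sub W x -> tens_sub W' y -> tens_sub (tens_prod W W') (tens_pair y x).
Proof.
move=> Wx Wy; elim: Wx => [|c _ p [b [u [Wu ->]]] _ IH].
  by rewrite linear0; apply: lspan0.
rewrite linearP /=; apply: lspan_add => //; apply: lspan_scale; rewrite tens_pairU.
elim: Wy => [|e _ q [b' [a [Wa ->]]] _ IHq]; first by rewrite linear0; apply: lspan0.
rewrite linearP /=; apply: lspan_add => //; apply: lspan_scale; rewrite tens_pair1E.
by apply/tens_sub_tens/lspan_mem; exists u, a.
Qed.

Lemma stable_tens W W' :
  stable deltaU W -> stable deltaA W' -> stable coact_tens (tens_prod W W').
Proof.
move=> dW dW' x; elim=> [|c _ p [u [a [Wu Wa ->]]] _ IH].
  by rewrite linear0; apply: lspan0.
rewrite linearP /=; apply: lspan_add => //; apply: lspan_scale; rewrite coact_tensE.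
by apply: tens_sub_pair; [apply: dW | apply: dW'].
Qed.

(** On the product basis the coefficient matrix is a Kronecker product, whose trace is the product
    of the traces in the same order. *)
Lemma is_character_tens W W' chi chi' : subspace W -> subspace W' ->
  is_character deltaU W chi -> is_character deltaA W' chi' ->
  is_character coact_tens (tens_prod W W') (chi * chi').
Proof.
move=> subW subW' [d [v [b [vB bE ->]]]] [e [w [c [wB cE ->]]]].
have vI := basis_indep subW vB; have wI := basis_indep subW' wB.
pose h (p q : 'I_d * 'I_e) := b p.1 q.1 * c p.2 q.2.
have -> : (\sum_i b i i) * (\sum_j c j j) =
    \sum_p h p p.
  rewrite mulr_suml sum_pair.
  by apply: eq_bigr => i _; rewrite mulr_sumr.
apply: (is_character_fin (v := fun p => tens (v p.1) (w p.2))).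
- move=> p; apply: lspan_mem; exists (v p.1), (w p.2).
  by split=> //; [apply: vB.1 | apply: wB.1].
- move=> g; rewrite sum_pair /= => g0.
  (* Grouping the relation along [w] and applying [tens_sum_inj] with [U] in the role of [B] gives,
     for each [j], a relation among the [v i]. *)
  case=> i j; apply: (vI (fun i => g (i, j))); move: j.
  apply: (tens_sum_inj (b := fun j => \sum_i g (i, j) *: v i) (b' := fun=> 0) wI).
  rewrite [RHS]big1 => [|j _]; last by rewrite tens0l.
  rewrite -[RHS]g0 [RHS]exchange_big; apply: eq_bigr => j _ /=.
  by rewrite tens_suml; apply: eq_bigr => l _; rewrite tensZl.
- move=> x; elim=> [|a _ y [u [z [Wu Wz ->]]] _ [g ->]].
    by exists (fun=> 0); rewrite big1 // => p _; rewrite scale0r.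
  have [r ->] := basis_span vB Wu; have [s ->] := basis_span wB Wz.
  exists (fun p => a * (r p.1 * s p.2) + g p).
  under [RHS]eq_bigr do rewrite scalerDl -scalerA.
  rewrite big_split -scaler_sumr /=; congr (_ *: _ + _).
  rewrite sum_pair /=.
  rewrite tens_suml; apply: eq_bigr => i _; rewrite tens_sumr; apply: eq_bigr => j _.
  by rewrite tensZl tensZr scalerA.
case=> i j; rewrite coact_tensE /= bE cE linear_sum sum_pair.
apply: eq_bigr => l _; rewrite /= tens_pair_suml.
by apply: eq_bigr => m _; rewrite tens_pairE.
Qed.

End Diagonal.

Section DiagonalShift.
Variables (k : fieldType) (B U A : algType k).
Variable f : {linear tensor U A -> tensor U A}.

(** If [f] carries the last factor [v i] across the tensor sign to a first factor [c i], the
    coefficient [b i] keeps its place between those of [x] and [y], so the products in [B] agree. *)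
Lemma tens_pair_map_shift (I : finType) (b : I -> B) (v : I -> U) (c : I -> A) :
  (forall i u a, f (tens (u * v i) a) = tens u (c i * a)) ->
  forall (x : tensor B U) (y : tensor B A),
  tens_map f (tens_pair y (x * (\sum_i tens (b i) (v i)))) =
  tens_pair ((\sum_i tens (b i) (c i)) * y) x.
Proof.
move=> fv x y; rewrite mulr_sumr mulr_suml tens_pair_suml.
rewrite (linear_sum (tens_pair y)) (linear_sum (tens_map f)).
apply: eq_bigr => i _ /=.
elim/tensor_ind: x => [|e u x IH]; first by rewrite mul0r !linear0.
rewrite mulrDl !linearD /= IH; congr (_ + _); rewrite tensM !tens_pairU.
elim/tensor_ind: y {IH} => [|d a y IH]; first by rewrite mulr0 !linear0.
rewrite mulrDr !linearD /= IH; congr (_ + _).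
by rewrite tensM !tens_pair1E tens_mapE /= fv mulrA.
Qed.

Lemma tens_pair_map1 : (forall a, f (tens 1 a) = 0) ->
  forall y : tensor B A, tens_map f (tens_pair y 1) = 0.
Proof.
move=> f1 y; rewrite -[1 in LHS]/(tens 1 1) tens_pairU.
elim/tensor_ind: y => [|d a y IH]; first by rewrite !linear0.
by rewrite !linearD /= IH tens_pair1E tens_mapE /= f1 tens0r addr0.
Qed.

End DiagonalShift.

Section TensorSubMul.
Variables (k : fieldType) (B C : algType k).

Lemma tens_sub_mul (W1 W2 W3 : set C) (x y : tensor B C) :
  (forall u v, W1 u -> W2 v -> W3 (u * v)) ->
  tens_sub W1 x -> tens_sub W2 y -> tens_sub W3 (x * y).
Proof.
move=> W123 Wx Wy; elim: Wx => [|c _ p [b [u [Wu ->]]] _ IH].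
  by rewrite mul0r; apply: lspan0.
rewrite mulrDl -tens_scalerAl; apply: lspan_add => //; apply: lspan_scale.
elim: Wy => [|e _ q [b' [a [Wa ->]]] _ IHq]; first by rewrite mulr0; apply: lspan0.
rewrite mulrDr -tens_scalerAr; apply: lspan_add => //; apply: lspan_scale.
by rewrite tensM; apply/tens_sub_tens/W123.
Qed.

End TensorSubMul.

(** * Gradings of the free algebra and of its quadratic quotients *)

Section FreeAlgebra.
Variables (k : fieldType) (X : choiceType).
Local Notation T := (freealg k X).

Lemma word_nil : word k [::] = 1 :> T.
Proof. by rewrite wordE; congr << _ >>; apply/eqP; rewrite fmP fm1. Qed.

Lemma word_span (p : T) : lspan [set word k s | s in [set: seq X]] p.
Proof.
elim/freealg_ind: p => [|c s p IH]; first exact: lspan0.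
by apply: lspanD => //; exists s.
Qed.

(** The sum inside [koszul_diff] has this form. *)
Definition word_ext (W : lmodType k) (F : seq X -> W) (u : T) : W :=
  \sum_(w <- msupp u) u@_w *: F (w : {fmonom X}).

Lemma word_ext_linear (W : lmodType k) (F : seq X -> W) : linear (word_ext F).
Proof.
have E (d : {fset {fmonom X}}) (u : T) : (msupp u `<=` d)%fset ->
    word_ext F u = \sum_(w <- d) u@_w *: F (w : {fmonom X}).
  move=> le_d; apply: big_fset_incl => // w _ /mcoeff_outdom ->.
  by rewrite scale0r.
move=> a u v; pose d := (msupp u `|` msupp v `|` msupp (a *: u + v))%fset.
have hw : (msupp (a *: u + v) `<=` d)%fset by exact: fsubsetUr.
have hu : (msupp u `<=` d)%fset by apply/fsubsetU; rewrite fsubsetUl.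
have hv : (msupp v `<=` d)%fset by apply/fsubsetU; rewrite fsubsetUr.
rewrite (E _ _ hw) (E _ _ hu) (E _ _ hv).
rewrite scaler_sumr -big_split; apply: eq_bigr => w _ /=.
suff -> : (a *: u + v)@_w = a * u@_w + v@_w by rewrite scalerDl scalerA.
by apply: etrans (mcoeffD _ _ _) _; congr (_ + _); exact: mcoeffZ.
Qed.

Lemma word_ext_word (W : lmodType k) (F : seq X -> W) s :
  word_ext F (word k s) = F s.
Proof. by rewrite /word_ext wordE msuppU1 big_seq_fset1 mcoeffUU scale1r. Qed.

Lemma subspace_freealg_deg m : subspace (@freealg_deg k X m).
Proof.
split=> [w|a p q pm qm w]; first by rewrite msupp0.
rewrite -mcoeff_neq0 => wpq; have : (p@_w != 0) || (q@_w != 0).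
  apply: contraR wpq; rewrite negb_or !negbK => /andP[/eqP p0 /eqP q0].
  suff -> : (a *: p + q)@_w = a * p@_w + q@_w by rewrite p0 q0 mulr0 addr0.
  by apply: etrans (mcoeffD _ _ _) _; congr (_ + _); exact: mcoeffZ.
by rewrite !mcoeff_neq0 => /orP[]; [apply: pm | apply: qm].
Qed.

Lemma freealg_deg_word s : freealg_deg (size s) (word k s : T).
Proof. by move=> w; rewrite wordE msuppU1 inE => /eqP ->. Qed.

(** Trades the condition on supports for a span of words, so that claims about homogeneous elements
    follow by induction on [lspan]. *)
Lemma freealg_degE m :
  @freealg_deg k X m = lspan [set w | exists2 s, size s = m & w = word k s].
Proof.
apply/seteqP; split=> [p pm|]; last first.
  apply: lspan_min; first exact: subspace_freealg_deg.
  by move=> _ [s <- ->]; apply: freealg_deg_word.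
have : p = \sum_(w <- msupp p) << p@_w *g w >> :> T by exact: monalgE.
move=> ->; rewrite big_seq; elim/big_rec: _ => [|w y pw IH]; first exact: lspan0.
have -> : << p@_w *g w >> = p@_w *: word k w :> T.
  rewrite wordE fmK; apply/malgP => v; apply: esym; apply: etrans (mcoeffZ _ _ _) _.
  by rewrite [X in _ * X]mcoeffU mcoeffU mulrnAr mulr1.
by apply: lspanD => //; exists w => //; apply: pm.
Qed.

Lemma freealg_degM m1 m2 (p q : T) :
  freealg_deg m1 p -> freealg_deg m2 q -> freealg_deg (m1 + m2) (p * q).
Proof.
rewrite !freealg_degE; elim=> [|a _ u [s sm ->] _ IH].
  by rewrite mul0r => _; apply: lspan0.
move=> qm; rewrite mulrDl -scalerAl; apply: lspan_add (IH qm); apply: lspan_scale.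
elim: qm {IH} => [|b _ v [t tm ->] _ IH]; first by rewrite mulr0; apply: lspan0.
rewrite mulrDr -scalerAr wordM; apply: lspanD => //.
by exists (s ++ t); rewrite // size_cat sm tm.
Qed.

Lemma freealg_deg1 : freealg_deg 0 (1 : T).
Proof. by rewrite -word_nil; exact: (@freealg_deg_word (nil : seq X)). Qed.

Lemma freealg_deg_gen x : freealg_deg 1 (gen k x : T).
Proof. by rewrite /gen; exact: (@freealg_deg_word [:: x : X]). Qed.

Lemma freealg_deg0 (p : T) : freealg_deg 0 p -> exists c : k, p = c *: 1.
Proof.
rewrite freealg_degE; elim=> [|a _ u [s /size0nil -> ->] _ [c ->]].
  by exists 0; rewrite scale0r.
by exists (a + c); rewrite word_nil scalerDl.
Qed.

Variables (B C : algType k).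

HB.instance Definition _ (f : X -> tensor B C) := GRing.isLinear.Build k T (tensor B C) _
  (free_map f) (free_map_linear f).

(** A word of length [m] goes to a product of [m] elements of [tens_sub (W 1)]. The grading [W] is
    later that of the free algebra or of the quadratic algebra. *)
Lemma free_map_deg (f : X -> tensor B C) (W : nat -> set C) :
  W 0%N 1 -> (forall i j u v, W i u -> W j v -> W (i + j)%N (u * v)) ->
  (forall x, tens_sub (W 1%N) (f x)) ->
  forall m p, freealg_deg m p -> tens_sub (W m) (free_map f p).
Proof.
move=> W1 WM Wf m p; rewrite freealg_degE.
elim=> [|a _ u [s sm ->] _ IH]; first by rewrite linear0; apply: lspan0.
rewrite linearP; apply: lspan_add => //; apply: lspan_scale; rewrite /= free_map_word.
elim: s m sm {IH} => [_ <-|x s IH _ <-]; first by rewrite big_nil; apply: tens_sub_tens.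
rewrite big_cons; apply: (tens_sub_mul (WM 1%N _)) => //.
exact: IH.
Qed.

End FreeAlgebra.

Lemma freealg_deg_span (k : fieldType) (X : finType) m (p : freealg k X) :
  freealg_deg m p -> exists c : m.-tuple X -> k, p = \sum_t c t *: word k t.
Proof.
rewrite freealg_degE; elim=> [|a _ u [s /eqP sm ->] _ [c ->]].
  by exists (fun=> 0); rewrite big1 // => t _; rewrite scale0r.
exists (fun t => a * (t == Tuple sm)%:R + c t).
under [RHS]eq_bigr do rewrite scalerDl.
rewrite big_split /=; congr (_ + _).
rewrite (bigD1 (Tuple sm)) //= eqxx mulr1 big1 ?addr0 // => t /negPf ->.
by rewrite mulr0 scale0r.
Qed.

Section QuadraticAlgebraDegrees.
Variables (k : fieldType) (X : finType) (S : set (X -> X -> k)).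
Local Notation A := (quadalg S).

HB.instance Definition _ := GRing.isLinear.Build k (freealg k X) A _
  (qa_pi S) (@qa_pi_linear k X S).

Lemma subspace_quadalg_deg m : subspace (@quadalg_deg k X S m).
Proof.
have [h0 hD] := @subspace_freealg_deg k X m; split=> [|a _ _ [p pm <-] [q qm <-]].
  by exists 0; rewrite ?linear0.
by exists (a *: p + q); [apply: hD | rewrite linearP].
Qed.

Lemma quadalg_degM i j (u v : A) :
  quadalg_deg i u -> quadalg_deg j v -> quadalg_deg (i + j) (u * v).
Proof.
by case=> p pi <- [q qj <-]; exists (p * q); [apply: freealg_degM | apply: qa_piM].
Qed.

Lemma quadalg_deg1 : quadalg_deg 0 (1 : A).
Proof. by exists 1; [apply: freealg_deg1 | apply: qa_pi1]. Qed.

Lemma quadalg_deg_span m (u : A) : quadalg_deg m u ->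
  exists c : m.-tuple X -> k, u = \sum_t c t *: qa_pi S (word k t).
Proof.
case=> p /freealg_deg_span[c ->] <-; exists c; rewrite linear_sum.
by apply: eq_bigr => t _; rewrite linearZ.
Qed.

End QuadraticAlgebraDegrees.

(** * Stability of the graded pieces under the coactions *)

Section Coactions.
Variables (k : fieldType) (n : nat) (R : {vspace 'M[k]_n}).
Local Notation T := (freealg k 'I_n).
Local Notation A := (quadalg (qrel R)).
Local Notation B := (quadalg (endrel R)).

HB.instance Definition _ := GRing.isLinear.Build k T (tensor B T) _
  (@coact_tensor k n R) (free_map_linear _).
HB.instance Definition _ := GRing.isLinear.Build k A (tensor B A) _
  (@coact_alg k n R) (@coact_alg_linear k n R).

Lemma stable_freealg_deg m : stable (@coact_tensor k n R) (freealg_deg m).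
Proof.
move=> p; apply: (free_map_deg (W := @freealg_deg k 'I_n)).
- exact: freealg_deg1.
- by move=> i j u v; apply: freealg_degM.
- by move=> i; apply: tens_sub_sum => j _; apply/tens_sub_tens/freealg_deg_gen.
Qed.

Lemma stable_quadalg_deg m : stable (@coact_alg k n R) (quadalg_deg m).
Proof.
move=> _ [p pm <-]; rewrite coact_algE.
apply: (free_map_deg (W := @quadalg_deg k 'I_n (qrel R))) pm.
- exact: quadalg_deg1.
- by move=> i j u v; apply: quadalg_degM.
move=> i; apply: tens_sub_sum => j _; apply: tens_sub_tens.
by exists (gen k j); [apply: freealg_deg_gen | ].
Qed.

(** Double annihilator: each entry of [m - projv R m] is the value at [m] of a form that vanishes on
    [R]. *)
Lemma perp_perp (m : 'M[k]_n) :
  (forall f, perp R f -> \sum_i \sum_j f i j * m i j = 0) -> m \in R.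
Proof.
move=> h; suff -> : m = projv R m by exact: memv_proj.
have projE (r : 'M[k]_n) a b : projv R r a b =
    \sum_c \sum_d (projv R (delta_mx c d) : 'M[k]_n) a b * r c d.
  rewrite {1}(matrix_sum_delta r) linear_sum summxE; apply: eq_bigr => c _.
  rewrite linear_sum summxE; apply: eq_bigr => d _.
  by rewrite linearZ mxE mulrC.
apply/matrixP => a b; apply/eqP; rewrite -subr_eq0 projE; apply/eqP.
pose f : 'M[k]_n :=
  \matrix_(c, d) ((c == a)%:R * (d == b)%:R - (projv R (delta_mx c d) : 'M[k]_n) a b).
have fE (r : 'M[k]_n) : \sum_c \sum_d f c d * r c d = r a b -
    \sum_c \sum_d (projv R (delta_mx c d) : 'M[k]_n) a b * r c d.
  have {1}-> : r a b = \sum_c \sum_d (c == a)%:R * (d == b)%:R * r c d.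
    rewrite (bigD1 a) //= (bigD1 b) //= !eqxx !mul1r.
    rewrite big1 ?addr0 => [|d /negPf ->]; last by rewrite mulr0 mul0r.
    rewrite big1 ?addr0 // => c /negPf ->.
    by rewrite big1 // => d _; rewrite !mul0r.
  rewrite -sumrB; apply: eq_bigr => c _; rewrite -sumrB; apply: eq_bigr => d _.
  by rewrite mxE mulrBl.
by rewrite -fE; apply: h => r rR; rewrite fE -projE projv_id // subrr.
Qed.

(** Matrices form a module, so this version of [quadelt] can be declared linear and fed to
    [tens_map]. *)
Definition quadelt_mx (r : 'M[k]_n) : T := quadelt r.

Lemma quadelt_mx_linear : linear quadelt_mx.
Proof.
move=> a r s; rewrite /quadelt_mx /quadelt scaler_sumr -big_split.
by apply: eq_bigr => p _ /=; rewrite !mxE scalerDl scalerA.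
Qed.

HB.instance Definition _ := GRing.isLinear.Build k 'M[k]_n T _
  quadelt_mx quadelt_mx_linear.

Lemma quadelt_mx_delta a b : quadelt_mx (delta_mx a b) = gen k a * gen k b.
Proof.
rewrite /quadelt_mx /quadelt (bigD1 (a, b)) //= mxE !eqxx scale1r big1 ?addr0 //.
by case=> c d; rewrite xpair_eqE mxE => /negPf ->; rewrite scale0r.
Qed.

Definition pairing (f m : 'M[k]_n) : k := \sum_i \sum_j f i j * m i j.

Lemma pairing_linear f : scalar (pairing f).
Proof.
move=> a r s; rewrite /pairing mulr_sumr -big_split; apply: eq_bigr => i _ /=.
rewrite mulr_sumr -big_split; apply: eq_bigr => j _ /=.
by rewrite !mxE mulrDr mulrCA.
Qed.

HB.instance Definition _ f := GRing.isLinear.Build k 'M[k]_n k *%R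
  (pairing f) (pairing_linear f).

(** The relations of [endalg R] say that pairing the coaction of [r] with any [f] in [perp R] gives
    0. With independent coefficients in [B], each matrix coefficient is then annihilated by
    [perp R], hence lies in [R] by [perp_perp]. *)
Lemma coact_quadelt (r : 'M[k]_n) : r \in R ->
  tens_sub [set quadelt_mx s | s in [set s | s \in R]] (coact_tensor R (quadelt_mx r)).
Proof.
move=> rR; pose C a b : B := \sum_c \sum_d r c d *: (endz R c a * endz R d b).
(* A lift of the coaction from the free algebra to matrices, where [pairing f] is defined. *)
pose y : tensor B 'M[k]_n := \sum_a \sum_b tens (C a b) (delta_mx a b).
have -> : coact_tensor R (quadelt_mx r) = tens_map quadelt_mx y.
  transitivity (\sum_a \sum_b tens (C a b) (gen k a * gen k b)).
    rewrite /quadelt_mx /quadelt linear_sum /= sum_pair /=.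
    transitivity (\sum_c \sum_d \sum_a \sum_b
        tens (r c d *: (endz R c a * endz R d b)) (gen k a * gen k b)).
      apply: eq_bigr => c _; apply: eq_bigr => d _.
      rewrite linearZ /= /coact_tensor free_mapM !free_map_gen.
      rewrite mulr_suml scaler_sumr; apply: eq_bigr => a _.
      rewrite mulr_sumr scaler_sumr; apply: eq_bigr => b _.
      by rewrite tensM tensZl.
    rewrite pair_bigA exchange_big; apply: eq_bigr => a _ /=.
    rewrite exchange_big; apply: eq_bigr => b _ /=.
    by rewrite sum_pair /C tens_suml; apply: eq_bigr => c _; rewrite tens_suml.
  rewrite linear_sum; apply: eq_bigr => a _; rewrite linear_sum; apply: eq_bigr => b _.
  by rewrite /= tens_mapE /= quadelt_mx_delta.
apply: (@tens_sub_map _ _ _ _ [set s | s \in R]) => [s sR|]; first by exists s.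
have [d [b [m [bI yE]]]] := tensor_indep y.
rewrite yE; apply: tens_sub_sum => i _; apply: tens_sub_tens; apply: perp_perp => f fR.
rewrite -[LHS]/(pairing f (m i)); apply: (bI (fun i => pairing f (m i))).
transitivity (contract_r (pairing f) y).
  by rewrite yE linear_sum; apply: eq_bigr => j _; rewrite /= contract_rE.
(* The relation attached to [f] and [r] is exactly the vanishing of the contraction of [y] by
   [pairing f]. *)
have h : endrel R (S23 f r) by exists f, r.
rewrite -[RHS](quadalg_rel h).
rewrite [RHS](sum_pair_pair (fun p q => S23 f r p q *:
            (qa_pi (endrel R) (gen k p) * qa_pi (endrel R) (gen k q)))).
rewrite linear_sum; apply: eq_bigr => a _; rewrite linear_sum; apply: eq_bigr => e _.
rewrite /= contract_rE /=.
have -> : pairing f (delta_mx a e) = f a e.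
  rewrite /pairing (bigD1 a) //= (bigD1 e) //= mxE !eqxx mulr1.
  rewrite big1 ?addr0 => [|l /negPf nl]; last by rewrite mxE nl andbF mulr0.
  rewrite big1 ?addr0 // => c /negPf nc; rewrite big1 // => l _.
  by rewrite mxE nc mulr0.
rewrite scaler_sumr; apply: eq_bigr => c _; rewrite scaler_sumr; apply: eq_bigr => l _.
by rewrite scalerA.
Qed.

Lemma subspace_koszul_dual m : subspace (koszul_dual R m).
Proof.
have [h0 hD] := @subspace_freealg_deg k 'I_n m.
split=> [|a u v [um uR] [vm vR]].
  by split=> // i j _; apply: lspan0.
split=> [|i j ij]; first exact: hD.
by apply: lspan_add (vR i j ij); apply: lspan_scale; apply: uR.
Qed.

(** One expression of the coaction of [u] with independent [b l] serves every condition of the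
    intersection: each passes separately to the [w l]. For a given [(i, j)] it follows from
    multiplicativity of the coaction and [coact_quadelt]. *)
Lemma stable_koszul_dual m : stable (@coact_tensor k n R) (koszul_dual R m).
Proof.
move=> u [um uR]; have [d [b [w [bI uE]]]] := tensor_indep (coact_tensor R u).
rewrite uE; apply: tens_sub_sum => l _; apply: tens_sub_tens; split.
  apply: (tens_sub_coef (m := w)) bI _ l; first exact: subspace_freealg_deg.
  by rewrite -uE; apply: stable_freealg_deg.
move=> i j ij; apply: (tens_sub_coef (m := w)) bI _ l; first exact: subspace_lspan.
rewrite -uE; elim: {um uR uE ij} (uR i j ij) => [|a _ v [p [r [q [pi rR qj ->]]]] _ IH].
  by rewrite linear0; apply: lspan0.
rewrite linearP; apply: lspan_add => //; apply: lspan_scale.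
rewrite /= /coact_tensor !free_mapM.
apply: (@tens_sub_mul _ _ _ [set v | exists p r, [/\ freealg_deg i p, r \in R
  & v = p * quadelt (fun_of_matrix r)]] (freealg_deg j)).
- move=> _ q' [p' [r' [pi' rR' ->]]] qj'; apply: lspan_mem.
  by exists p', r', q'; split.
- apply: (@tens_sub_mul _ _ _ (freealg_deg i)); last exact: coact_quadelt rR.
    by move=> p' _ pi' [s sR <-]; exists p', s.
  exact: stable_freealg_deg.
exact: stable_freealg_deg.
Qed.

End Coactions.

(** * The Koszul complex as a complex of comodules *)

Section KoszulComplex.
Variables (k : fieldType) (n : nat) (R : {vspace 'M[k]_n}).
Local Notation T := (freealg k 'I_n).
Local Notation A := (quadalg (qrel R)).
Local Notation B := (quadalg (endrel R)).
Local Notation TA := (tensor T A).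
Local Notation deltaT := (@coact_tensor k n R).
Local Notation deltaA := (@coact_alg k n R).
Local Notation deltaTA := (coact_tens (deltaT : {linear T -> tensor B T})
                                      (deltaA : {linear A -> tensor B A})).

Fact koszul_diff_bilin :
  (forall a : A, linear (fun u : T => word_ext (fun w => koszul_diff_word w a) u)) /\
  (forall u : T, linear (fun a : A => word_ext (fun w => koszul_diff_word w a) u)).
Proof.
split=> [a|u c a b]; first exact: word_ext_linear.
rewrite /word_ext scaler_sumr -big_split; apply: eq_bigr => w _ /=.
rewrite scalerA mulrC -scalerA -scalerDr; congr (_ *: _).
case: (w : seq _) => [|i s] /=; first by rewrite scaler0 addr0.
by rewrite mulrDr -scalerAr tensDr tensZr.
Qed.

Lemma koszul_diff_linear : linear (@koszul_diff k n R).
Proof. by have [h1 h2] := koszul_diff_bilin; apply: tlift_linear. Qed.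

HB.instance Definition _ := GRing.isLinear.Build k TA TA _
  (@koszul_diff k n R) koszul_diff_linear.

Lemma koszul_diff_tens (u : T) (a : A) :
  koszul_diff (tens u a) = word_ext (fun w => koszul_diff_word w a) u.
Proof.
have [h1 h2] := koszul_diff_bilin.
exact: (tliftE (f := fun u a => word_ext (fun w => koszul_diff_word w a) u)).
Qed.

Lemma koszul_diff1 (a : A) : koszul_diff (tens (1 : T) a) = 0.
Proof. by rewrite koszul_diff_tens -word_nil word_ext_word. Qed.

Lemma koszul_diffM (p : T) i (a : A) :
  koszul_diff (tens (p * gen k i) a) = tens p (qx R i * a).
Proof.
elim/freealg_ind: p => [|c s p IH]; first by rewrite mul0r !tens0l linear0.
rewrite mulrDl -scalerAl !tensDl !tensZl linearP /= IH; congr (_ *: _ + _).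
rewrite /gen wordM /= koszul_diff_tens word_ext_word cats1.
(* [koszul_diff_word] matches on the first letter, whereas [i] is the last one. *)
case: s => [|j s] //=.
by rewrite belast_rcons last_rcons.
Qed.

(** The last letter [i] of a word and the generator [qx R i] have the same coaction coefficients
    [endz R i j], so moving one to the other commutes with the coaction. The empty word gives 0 on
    both sides. *)
Lemma koszul_diff_coact x :
  tens_map (@koszul_diff k n R) (deltaTA x) = deltaTA (koszul_diff x).
Proof.
refine (@coact_tens_map k B T A deltaT deltaA (@koszul_diff k n R) _
  (@word_span k 'I_n) _ x) => _ a [s _ <-].
rewrite coact_tensE /=; case/lastP: s => [|s i].
  rewrite word_nil koszul_diff1 linear0 [coact_tensor R 1]free_map1.
  exact: (@tens_pair_map1 k B T A (@koszul_diff k n R) koszul_diff1).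
rewrite -cats1 -wordM -[word k [:: i]]/(gen k i) koszul_diffM coact_tensE /=.
rewrite [coact_tensor R _]free_mapM coact_algM coact_alg_x free_map_gen.
exact: (@tens_pair_map_shift k B T A (@koszul_diff k n R) _ _ _ _
  (fun j u c => koszul_diffM u j c)).
Qed.

(** A character exists by stability and finite dimension, so the [xget] in [char_dual] does not
    return its default value. *)
Lemma is_character_koszul_dual m :
  is_character deltaT (koszul_dual R m) (char_dual R m).
Proof.
have [|chi chiE] := @is_character_stable _ _ _ deltaT _ _ (fun t : m.-tuple 'I_n => word k t)
  (subspace_koszul_dual R m) (@stable_koszul_dual _ _ _ _).
  by move=> u [um _]; apply: freealg_deg_span.
by rewrite /char_dual (characterE (subspace_koszul_dual R m) chiE).
Qed.

Lemma is_character_quadalg l :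
  is_character deltaA (quadalg_deg l) (char_alg R l).
Proof.
have [|chi chiE] := @is_character_stable _ _ _ deltaA _ _
  (fun t : l.-tuple 'I_n => qa_pi (qrel R) (word k t))
  (subspace_quadalg_deg _ l) (@stable_quadalg_deg _ _ _ _).
  by move=> u /quadalg_deg_span.
by rewrite /char_alg (characterE (subspace_quadalg_deg _ l) chiE).
Qed.

Lemma is_character_koszul_term m j :
  is_character deltaTA (koszul_term (R := R) m j) (char_dual R m * char_alg R j).
Proof.
apply: is_character_tens; first exact: subspace_koszul_dual.
- exact: subspace_quadalg_deg.
- exact: is_character_koszul_dual.
- exact: is_character_quadalg.
Qed.

Definition koszul_cycle m j : set TA :=
  koszul_term m j `&` [set x | koszul_diff x = 0].

Lemma subspace_koszul_cycle m j : subspace (koszul_cycle m j).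
Proof.
apply: subspaceI; first exact: subspace_lspan.
split=> [|a x y /= x0 y0]; first by rewrite /= linear0.
by rewrite linearP /= x0 y0 scaler0 addr0.
Qed.

Definition char_cycle m j : B := character deltaTA (koszul_cycle m j).

(** The kernel of a colinear map is stable by [tens_sub_ker], and a basis of the whole term bounds
    its dimension. *)
Lemma is_character_cycle m j :
  is_character deltaTA (koszul_cycle m j) (char_cycle m j).
Proof.
have [d [v [b [vB _ _]]]] := is_character_koszul_term m j.
have stC : stable deltaTA (koszul_cycle m j).
  move=> x [Cx x0]; apply: tens_sub_ker; first exact: subspace_lspan.
    apply: stable_tens Cx; first exact: stable_koszul_dual.
    exact: stable_quadalg_deg.
  by rewrite koszul_diff_coact x0 linear0.
have [|chi chiE] := is_character_stable (w := v) (subspace_koszul_cycle m j) stC.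
  by move=> x [Cx _]; apply: basis_span vB Cx.
by rewrite /char_cycle (characterE (subspace_koszul_cycle m j) chiE).
Qed.

Lemma is_character0 : is_character deltaTA [set 0] 0.
Proof.
have -> : (0 : B) = \sum_(i < 0) 0 by rewrite big_ord0.
apply: (is_character_fin (v := fun=> 0) (b := fun _ _ => 0)) => [[]//|c _ []//|x ->|[]//].
by exists (fun=> 0); rewrite big_ord0.
Qed.

(** At the right end [koszul_diff] vanishes, since elements of degree 0 in the free algebra are
    scalars; the whole term consists of cycles. *)
Lemma char_term0 j : char_dual R 0 * char_alg R j = char_cycle 0 j.
Proof.
apply: (is_character_uniq (delta := deltaTA) (W := koszul_cycle 0 j)).
- exact: subspace_koszul_cycle.
- suff -> : koszul_cycle 0 j = koszul_term 0 j by exact: is_character_koszul_term.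
  apply/seteqP; split=> [x []//|x Cx]; split=> //=.
  elim: Cx => [|a _ y [u [c [[/freealg_deg0[e ->] _] _ ->]]] _ IH].
    by rewrite linear0.
  by rewrite linearP /= IH tensZl linearZ /= koszul_diff1 !scaler0 addr0.
exact: is_character_cycle.
Qed.

End KoszulComplex.

Lemma is_character_unit (k : fieldType) (B M : algType k)
    (delta : M -> tensor B M) (W : set M) :
  (1 : M) != 0 -> W 1 -> delta 1 = 1 -> (forall x, W x -> exists c : k, x = c *: 1) ->
  is_character delta W 1.
Proof.
move=> M1 W1 d1 Wspan.
have -> : (1 : B) = \sum_(i : unit) 1 by rewrite (big_pred1 tt) // => -[].
apply: (is_character_fin (v := fun=> 1) (b := fun _ _ => 1)) => // [c|x /Wspan[c ->]|].
- rewrite (big_pred1 tt) => [|[]] // /eqP; rewrite scaler_eq0 (negPf M1) orbF.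
  by move=> /eqP c0 [].
- by exists (fun=> c); rewrite (big_pred1 tt) // => -[].
by move=> _; rewrite d1 (big_pred1 tt) // => -[].
Qed.

(** * Exactness and the alternating sum of characters *)

Section KoszulExact.
Variables (k : fieldType) (n : nat) (R : {vspace 'M[k]_n}).
Local Notation T := (freealg k 'I_n).
Local Notation A := (quadalg (qrel R)).
Local Notation B := (quadalg (endrel R)).
Local Notation TA := (tensor T A).
Local Notation deltaT := (@coact_tensor k n R).
Local Notation deltaA := (@coact_alg k n R).
Local Notation deltaTA := (coact_tens (deltaT : {linear T -> tensor B T})
                                      (deltaA : {linear A -> tensor B A})).

Lemma char_alg0 : char_alg R 0 = 1.
Proof.
apply: characterE; first exact: subspace_quadalg_deg.
apply: is_character_unit; first exact: oner_neq0.
- exact: quadalg_deg1.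
- exact: coact_alg1.
move=> _ [p /freealg_deg0[c ->] <-]; exists c.
by rewrite linearZ /= qa_pi1.
Qed.

Lemma char_dual0 : char_dual R 0 = 1.
Proof.
apply: characterE; first exact: subspace_koszul_dual.
apply: is_character_unit; first exact: oner_neq0.
- by split; [apply: freealg_deg1 | case].
- exact: free_map1.
by move=> u [/freealg_deg0].
Qed.

Hypothesis koszulA : koszul R.

(** The differential presents the term as an extension of its image by its cycles; exactness in
    bidegree [(m, j.+1)] identifies that image with the cycles there. *)
Lemma char_termS m j :
  char_dual R m.+1 * char_alg R j = char_cycle R m.+1 j + char_cycle R m j.+1.
Proof.
apply: (is_character_uniq (delta := deltaTA) (W := koszul_term m.+1 j)).
- exact: subspace_lspan.
- exact: is_character_koszul_term.
refine (@is_character_exact k B TA TA deltaTA deltaTA (@koszul_diff k n R) _ _ _ _ _ _ _ _).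
- exact: subspace_lspan.
- apply: stable_tens; first exact: stable_koszul_dual.
  exact: stable_quadalg_deg.
- by move=> x _; apply: koszul_diff_coact.
- exact: is_character_cycle.
have <- : koszul_cycle m j.+1 = @koszul_diff k n R @` koszul_term m.+1 j.
  by apply: (koszulA (l := (m + j.+1)%N)) => //; rewrite addnS.
exact: is_character_cycle.
Qed.

(** At the left end [koszul_im] is [[set 0]], so exactness means that the differential is
    injective. *)
Lemma char_cycle0 m : (0 < m)%N -> char_cycle R m 0 = 0.
Proof.
move=> m0; apply: (is_character_uniq (delta := deltaTA) (W := koszul_cycle m 0)).
- exact: subspace_koszul_cycle.
- exact: is_character_cycle.
have -> : koszul_cycle (R := R) m 0 = [set 0] by exact: (koszulA m0 (addn0 m)).
exact: is_character0.
Qed.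

Lemma koszul_euler l : (0 < l)%N ->
  \sum_(m < l.+1) (-1) ^+ m * char_dual R m * char_alg R (l - m)%N = 0.
Proof.
(* The alternating sum telescopes: only the cycles of the last term included survive, and for
   [p = l] these are zero. *)
move=> l0; suff h p : (p <= l)%N ->
    \sum_(m < p.+1) (-1) ^+ m * char_dual R m * char_alg R (l - m)%N =
    (-1) ^+ p * char_cycle R p (l - p)%N.
  by rewrite h // subnn char_cycle0 // mulr0.
elim: p => [_|p IH lep]; first by rewrite big_ord1 expr0 !mul1r subn0 char_term0.
rewrite big_ord_recr /= IH; last exact: ltnW.
rewrite -mulrA char_termS -subSn // subSS mulrDr addrCA.
by rewrite exprS mulN1r !mulNr subrr addr0.
Qed.

End KoszulExact.

(* With E = f g - 1, associativity gives E f = f (g f) - f = 0, so E = 0 as f has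
   constant coefficient 1; polynomials truncated at degree d supply associativity. *)
Lemma ps_mul_comm_inv (B : nzRingType) (f g : pseries B) :
  f 0%N = 1 -> ps_mul g f = ps_one B -> ps_mul f g = ps_one B.
Proof.
move=> f0 gf; apply/funext => d; elim/ltn_ind: d => d IH.
pose P := \poly_(i < d.+1) f i; pose Q := \poly_(i < d.+1) g i.
have coefPQ (u v : pseries B) i : (i <= d)%N ->
    ((\poly_(i < d.+1) u i) * (\poly_(i < d.+1) v i))`_i = ps_mul u v i.
  move=> lei; rewrite coefM; apply: eq_bigr => j _.
  by rewrite !coef_poly !ltnS (leq_trans (leq_ord j)) ?(leq_trans (leq_subr _ _)).
(* Bracketed as [P * (Q * P)], the hypothesis on [ps_mul g f] leaves only the coefficient [f d]. *)
have PQP : (P * Q * P)`_d = f d.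
  rewrite -mulrA coefM (bigD1 ord_max) //= subnn coefPQ // gf /ps_one mulr1.
  rewrite coef_poly ltnSn big1 ?addr0 // => j jd.
  rewrite coefPQ ?leq_subr // gf /ps_one subn_eq0 leqNgt.
  have -> : (j < d)%N by rewrite ltn_neqAle jd -ltnS ltn_ord.
  by rewrite mulr0.
(* Bracketed as [(P * Q) * P]: for positive [d], induction makes the lower coefficients of [P * Q]
   contribute just [f d], so the coefficient of degree [d] must be 0. *)
move: PQP; rewrite coefM big_ord_recr /= subnn [P`_0]coef_poly f0 mulr1 coefPQ //.
case: d => [|d] in IH P Q coefPQ *; first by rewrite big_ord0 add0r f0.
rewrite big_ord_recl coefPQ // IH // /ps_one mul1r subn0 coef_poly ltnSn.
rewrite big1 => [|j _]; last first.
  by rewrite coefPQ ?IH ?mul0r // /= /bump add1n ltnW // ltnS.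
by rewrite addr0 -[RHS]addr0 => /addrI.
Qed.

Theorem mainTheorem2 (k : fieldType) (n : nat) (R : {vspace 'M[k]_n})
    (koszulA : koszul R) :
  ps_mul (fun l => char_alg R l) (fun m => (-1) ^+ m * char_dual R m) =
  ps_one (endalg R).
Proof.
apply: ps_mul_comm_inv; first exact: char_alg0.
apply/funext => -[|l]; last exact: koszul_euler.
by rewrite /ps_mul big_ord1 expr0 char_dual0 char_alg0 !mul1r.
Qed.
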